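(* Let $d\ge2$. For every $\varepsilon>0$ there are constants $M=M(\varepsilon)<\infty$ and $\gamma=\gamma(\varepsilon)>0$ (which may also depend on $d$ and on the distribution of $\tau_e$) such that for every $z\in\mathbf{Z}^d$ and every $x\ge\|z\|$, $$\mathbf{P}\bigl(T(0,z)-\mu(z)<-\varepsilon x\bigr)\le M e^{-\gamma x}.$$
   Context: First-passage percolation on the nearest-neighbour lattice $\mathbf{Z}^d$, $d\ge2$, with edge set $\mathcal{E}$. The edge weights $\{\tau_e\}_{e\in\mathcal{E}}$ are nonnegative i.i.d. random variables (no further assumption). For a path $\Gamma$, $T(\Gamma)=\sum_{e\in\Gamma}\tau_e$, and $T(y,z)=\inf\{T(\Gamma):\Gamma\text{ is a path connecting }y\text{ and }z\}$. The time constant is $\mu(z)=\lim_{n\to\infty}T(0,nz)/n$ (limit in probability) for $z\in\mathbf{Z}^d$; it exists as a finite deterministic number without any condition on the weight distribution. $\|\cdot\|$ is the $\ell^1$-norm. *)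

(* Defs.v *)
From mathcomp Require Import all_boot all_order all_algebra.
From mathcomp Require Import all_classical all_reals all_analysis.

Set Implicit Arguments.
Unset Strict Implicit.
Unset Printing Implicit Defensive.

Import Order.TTheory GRing.Theory Num.Theory.
Import numFieldNormedType.Exports.

Local Open Scope classical_set_scope.
Local Open Scope ring_scope.

Section Lattice.
Variable d : nat.

Definition vertex : Type := 'rV[int]_d.

Definition l1norm (z : vertex) : int := \sum_(i < d) `|z 0 i|.

(* The pair (x, i) encodes the undirected edge {x, x + e_i}, where e_i is the
   i-th coordinate vector; each nearest-neighbour edge has exactly one code. *)
Definition edge : Type := (vertex * 'I_d)%type.

Definition edge_tail (e : edge) : vertex := e.1.
Definition edge_head (e : edge) : vertex := e.1 + delta_mx 0 e.2.

Definition joins (e : edge) (x y : vertex) : bool :=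
  (x == edge_tail e) && (y == edge_head e)
  || (x == edge_head e) && (y == edge_tail e).

(* A path y, e_1, v_1, ..., e_k, v_k = z is given by its starting point y and
   the sequence of the pairs (e_j, v_j).  Repetitions are allowed. *)
Fixpoint connects (y z : vertex) (p : seq (edge * vertex)) : bool :=
  if p is (e, v) :: p' then joins e y v && connects v z p' else y == z.

End Lattice.

Section Probability.
Context {disp : measure_display} {Omega : measurableType disp} {R : realType}.
Variable P : probability Omega R.

Definition mutually_independent (I : choiceType) (X : I -> {RV P >-> R}) :=
  forall (s : seq I) (A : I -> set R),
    uniq s -> (forall i, measurable (A i)) ->
    P (\bigcap_(i in [set` s]) X i @^-1` A i)
    = (\prod_(i <- s) P (X i @^-1` A i))%E.

Definition identically_distributed (I : Type) (X : I -> {RV P >-> R}) :=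
  forall (i j : I) (A : set R), measurable A ->
    distribution P (X i) A = distribution P (X j) A.

Definition cvg_in_probability (X : nat -> Omega -> R) (c : R) :=
  forall delta : R, 0 < delta ->
    P [set w | delta <= `|X n w - c|] @[n --> \oo] --> 0%E.

End Probability.

Section FirstPassage.
Context {disp : measure_display} {Omega : measurableType disp} {R : realType}.
Context {P : probability Omega R} {d : nat}.
Variable tau : edge d -> {RV P >-> R}.

Definition path_time (p : seq (edge d * vertex d)) (w : Omega) : R :=
  \sum_(ev <- p) tau ev.1 w.

Definition passage_time (y z : vertex d) (w : Omega) : R :=
  inf [set path_time p w | p in [set p | connects y z p]].

(* [xget 0] selects the (unique) limit in probability of T(0, n z) / n; the
   default value 0 would be returned only if this limit failed to exist. *)
Definition time_constant (z : vertex d) : R :=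
  xget 0 [set m | cvg_in_probability P
                    (fun n w => passage_time 0 (z *+ n) w / n%:R) m].

End FirstPassage.

(* Main.v *)
Require Import Defs.
From mathcomp Require Import all_boot all_order all_algebra fingroup perm.
From mathcomp Require Import all_classical all_reals all_analysis.
From mathcomp Require Import ring lra zify.

Set Implicit Arguments.
Unset Strict Implicit.
Unset Printing Implicit Defensive.

Import Order.TTheory GRing.Theory Num.Theory.
Import numFieldNormedType.Exports.

Local Open Scope classical_set_scope.
Local Open Scope ring_scope.

(* The norm nu dominates the time constant, is subadditive by the Harris
   inequality, and is bounded below by a multiple of the sup norm as soon as one
   time constant is positive.  Cut the lattice into boxes of a large side n and
   record the boxes at mutual distance K that a path visits.  The consecutive
   crossings use disjoint edges, so by a van den Berg-Kesten argument the Laplace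
   transform of the cost of such a skeleton is bounded by a product over its
   steps.  For a step w, the factor is governed by the probability that a box is
   joined to its translate by w at a cost below n * (nu w - small); since the
   edges inside the two boxes are independent of the crossing, and since the
   weights below a high threshold percolate inside a box (planar contour
   argument), this is at most twice the same probability for two points, which
   vanishes as n grows.  The number of steps w does not depend on n, hence the
   transforms beat the entropy of the skeletons. *)

(** The weights may have infinite mean, so that a vertex can be enclosed by very slow edges, and
    point-to-point times have no usable moments. Hence [nu] only asks that a cost be achieved with
    probability bounded away from zero: the Harris inequality multiplies two such probabilities, so
    the condition is stable under addition of directions. Conversely, a cost below [nu] has
    arbitrarily small probability along the ultrafilter, which is all that the lower tail requires.

    The correlation inequalities rest on resampling the coordinates of a finite product, whereas
    edges are infinite in number and weights are real. So finitely many edges are kept and the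
    weights are rounded down to a finite grid; the slack [eta] in many statements pays for the
    rounding.

    The constants are chosen in the order [K], [s], [delta], [n]. The distance [K] between recorded
    boxes makes the cost of the connections inside boxes, of order [n], negligible against
    [e * K * n]; then [s] beats the number of steps, [delta] beats the exponential of the largest
    step, and the scale [n] realises [delta]. *)

(** * Correlation inequalities on a finite product space *)

Section FiniteProduct.
Variables (R : realType) (J K : finType) (q : K -> R).
Hypotheses (q_ge0 : forall k, 0 <= q k) (q_sum1 : \sum_k q k = 1).
Local Notation cfg := {ffun J -> K}.

Definition wt (c : cfg) : R := \prod_e q (c e).

Definition Ex (f : cfg -> R) : R := \sum_c wt c * f c.

Lemma wt_ge0 c : 0 <= wt c.
Proof. exact: prodr_ge0. Qed.

Lemma wt_sum1 : \sum_c wt c = 1.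
Proof.
rewrite /wt -(bigA_distr_bigA (fun=> q)) /=.
by rewrite big1 // => i _; rewrite q_sum1.
Qed.

Lemma Ex_cst a : Ex (fun=> a) = a.
Proof. by rewrite /Ex -mulr_suml wt_sum1 mul1r. Qed.

Lemma Ex_le f g : (forall c, f c <= g c) -> Ex f <= Ex g.
Proof. by move=> fg; apply: ler_sum => c _; rewrite ler_wpM2l ?wt_ge0. Qed.

Lemma ExD f g : Ex (fun c => f c + g c) = Ex f + Ex g.
Proof. by rewrite /Ex -big_split; apply: eq_bigr => c _; rewrite mulrDr. Qed.

Lemma ExZ a f : Ex (fun c => a * f c) = a * Ex f.
Proof. by rewrite /Ex mulr_sumr; apply: eq_bigr => c _; rewrite mulrCA. Qed.

Lemma Ex_sum (T : Type) (s : seq T) (f : T -> cfg -> R) :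
  Ex (fun c => \sum_(t <- s) f t c) = \sum_(t <- s) Ex (f t).
Proof.
rewrite /Ex exchange_big /=; apply: eq_bigr => c _.
by rewrite mulr_sumr.
Qed.

Definition upd (x : cfg) e k : cfg := [ffun e' => if e' == e then k else x e'].

Lemma upd_id x e : upd x e (x e) = x.
Proof. by apply/ffunP => i; rewrite ffunE; case: eqP => // ->. Qed.

Definition mix (S : seq J) (x y : cfg) : cfg :=
  [ffun e => if e \in S then y e else x e].

Definition swap1 e (p : cfg * cfg) : cfg * cfg :=
  (upd p.1 e (p.2 e), upd p.2 e (p.1 e)).

Lemma swap1K e : involutive (swap1 e).
Proof.
move=> [x y]; rewrite /swap1 /=; congr pair; apply/ffunP => i.
  by rewrite !ffunE eqxx; case: eqP => // ->.
by rewrite !ffunE eqxx; case: eqP => // ->.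
Qed.

Lemma wt_swap1 e p : wt (swap1 e p).1 * wt (swap1 e p).2 = wt p.1 * wt p.2.
Proof.
rewrite /wt -!big_split /=; apply: eq_bigr => i _.
by rewrite !ffunE; case: eqP => // ->; rewrite mulrC.
Qed.

(* The coordinates of the second argument are resampled one at a time; the
   hypothesis says that each resampling can only increase the expectation. *)
Lemma decouple (F : cfg -> cfg -> R) :
  (forall e x y k l, F (upd x e k) (upd y e k) + F (upd x e l) (upd y e l)
                  <= F (upd x e k) (upd y e l) + F (upd x e l) (upd y e k)) ->
  Ex (fun x => F x x) <= Ex (fun x => Ex (F x)).
Proof.
move=> Fle.
pose G S := \sum_(p : cfg * cfg) wt p.1 * wt p.2 * F p.1 (mix S p.1 p.2).
have G0 : G [::] = Ex (fun x => F x x).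
  rewrite /G -(pair_bigA _ (fun x y => wt x * wt y * F x (mix [::] x y))) /=.
  apply: eq_bigr => x _.
  rewrite (eq_bigr (fun y => wt y * (wt x * F x x))); last first.
    move=> y _; rewrite (_ : mix _ _ _ = x); first by ring.
    by apply/ffunP => i; rewrite ffunE.
  by rewrite -mulr_suml wt_sum1 mul1r.
have G1 : G (enum J) = Ex (fun x => Ex (F x)).
  rewrite /G -(pair_bigA _ (fun x y => wt x * wt y * F x (mix (enum J) x y))) /=.
  apply: eq_bigr => x _; rewrite /Ex mulr_sumr; apply: eq_bigr => y _.
  rewrite (_ : mix _ _ _ = y) ?mulrA //.
  by apply/ffunP => i; rewrite ffunE mem_enum.
rewrite -G0 -G1.
elim: (enum J) (enum_uniq J) => // e S IH /= /andP[eS uS].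
apply: (le_trans (IH uS)).
have Gsym T : G T + G T = \sum_(p : cfg * cfg) wt p.1 * wt p.2 *
    (F p.1 (mix T p.1 p.2)
     + F (swap1 e p).1 (mix T (swap1 e p).1 (swap1 e p).2)).
  rewrite [X in _ + X]/G (reindex_inj (inv_inj (swap1K e))) -big_split /=.
  by apply: eq_bigr => p _; rewrite wt_swap1 mulrDr.
suff : G S + G S <= G (e :: S) + G (e :: S) by lra.
rewrite !Gsym; apply: ler_sum => -[x y] _ /=.
rewrite ler_wpM2l ?mulr_ge0 ?wt_ge0 //.
set z := mix S x y.
have := Fle e x z (x e) (y e); rewrite upd_id.
have -> : upd z e (x e) = z.
  by rewrite -[RHS](upd_id z e) {3}/z ffunE (negbTE eS).
have -> : mix S (upd x e (y e)) (upd y e (x e)) = upd z e (y e).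
  apply/ffunP => i; rewrite !ffunE; case: eqP => // ->.
  by rewrite (negbTE eS).
have -> : mix (e :: S) x y = upd z e (y e).
  by apply/ffunP => i; rewrite !ffunE inE; case: eqP => // ->.
have -> // : mix (e :: S) (upd x e (y e)) (upd y e (x e)) = z.
apply/ffunP => i; rewrite !ffunE inE; case: eqP => //= ->.
by rewrite (negbTE eS).
Qed.

Lemma Ex_prod f g : Ex (fun x => Ex (fun y => f x * g y)) = Ex f * Ex g.
Proof. by under eq_fun do rewrite ExZ mulrC; rewrite ExZ mulrC. Qed.

Lemma ExN f : Ex (fun x => - f x) = - Ex f.
Proof. by under eq_fun do rewrite -mulN1r; rewrite ExZ mulN1r. Qed.

(** The set [K] carries no order; it suffices that a change of one coordinate from [k] to [l] moves
    [f] and [g] in the same direction. The product of the two increments is then nonnegative, which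
    is the hypothesis of [decouple] for the kernel [- (f x * g y)]. *)
Lemma Ex_harris (f g : cfg -> R) :
  (forall e k l,
     ((forall x, f (upd x e k) <= f (upd x e l)) /\ (forall x, g (upd x e k) <= g (upd x e l))) \/
     ((forall x, f (upd x e l) <= f (upd x e k)) /\ (forall x, g (upd x e l) <= g (upd x e k)))) ->
  Ex f * Ex g <= Ex (fun x => f x * g x).
Proof.
move=> mono; rewrite -lerN2 -ExN -Ex_prod -ExN.
under [in X in _ <= X]eq_fun do rewrite -ExN.
apply: (decouple (F := fun x y => - (f x * g y))) => e x y k l.
by case: (mono e k l) => -[/(_ x) + /(_ y)];
  move: (f _) (f _) (g _) (g _) => a b a' b'; nra.
Qed.

(** Each coordinate influences only one of the two factors, so exchanging it between the copies
    leaves the sums compared in [decouple] equal. *)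
Lemma Ex_indep (D : pred J) (f g : cfg -> R) :
  (forall e x k, D e -> f (upd x e k) = f x) ->
  (forall e x k, ~~ D e -> g (upd x e k) = g x) ->
  Ex f * Ex g <= Ex (fun x => f x * g x).
Proof.
move=> fD gD; rewrite -lerN2 -ExN -Ex_prod -ExN.
under [in X in _ <= X]eq_fun do rewrite -ExN.
apply: (decouple (F := fun x y => - (f x * g y))) => e x y k l.
have [De|nDe] := boolP (D e); last by rewrite !(gD _ _ _ nDe).
by rewrite !(fD _ _ _ De) addrC.
Qed.

(** * Disjoint occurrence and Laplace transforms of minimal costs *)

Variable phi : K -> R.
Hypothesis phi_gt0 : forall k, 0 < phi k.

Definition Xw (r : {set J}) (x : cfg) : R := \prod_(e in r) phi (x e).

(** When [phi] is an exponential of minus a multiple of the weight, the expectation of this maximum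
    is the Laplace transform of the minimal cost over [A]; the value 0 for an empty [A] stands for
    an infinite cost. *)
Definition Mx (A : {set {set J}}) (x : cfg) : R :=
  \big[Num.max/0]_(r in A) Xw r x.

Lemma Xw_ge0 r x : 0 <= Xw r x.
Proof. by apply: prodr_ge0 => e _; apply: ltW. Qed.

Lemma Mx_ge0 A x : 0 <= Mx A x.
Proof.
by rewrite /Mx; elim/big_ind: _ => // [a b a0 b0|r _]; rewrite ?le_max ?a0 ?Xw_ge0.
Qed.

Lemma Mx_leP (A : {set {set J}}) x b : 0 <= b ->
  reflect (forall r, r \in A -> Xw r x <= b) (Mx A x <= b).
Proof.
move=> b0; by apply: (iffP idP) => [/bigmax_leP[_ H] r /H//|H]; apply/bigmax_leP; split.
Qed.

Lemma le_Mx (A : {set {set J}}) x r : r \in A -> Xw r x <= Mx A x.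
Proof. by move=> rA; rewrite /Mx (bigmax_sup r). Qed.

Lemma Xw_upd e r x k :
  Xw r (upd x e k) = (if e \in r then phi k else 1) * Xw (r :\ e) x.
Proof.
rewrite /Xw; case: ifP => er.
  rewrite (big_setD1 e) //= ffunE eqxx; congr *%R.
  by apply: eq_bigr => i; rewrite !inE ffunE => /andP[/negbTE ->].
rewrite mul1r (_ : (r :\ e)%SET = r); last first.
  by apply/setP => i; rewrite !inE; case: eqP => // ->; rewrite er.
by apply: eq_bigr => i ir; rewrite ffunE; case: eqP ir => // ->; rewrite er.
Qed.

(** Disjoint occurrence in the sense of van den Berg and Kesten. *)
Definition djoin (A B : {set {set J}}) : {set {set J}} :=
  [set t | [exists r in A, exists s in B, [disjoint r & s] && (t == r :|: s)]]%SET.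

Let Pr (A B : {set {set J}}) x y : R :=
  \big[Num.max/0]_(p : {set J} * {set J} |
     [&& p.1 \in A, p.2 \in B & [disjoint p.1 & p.2]]) (Xw p.1 x * Xw p.2 y).

(* The van den Berg-Kesten inequality for weights: at most one of two disjoint
   sets contains a given coordinate, so that resampling this coordinate in one
   of the two factors only increases the expected maximum. *)
Lemma Mx_bk A B : Ex (Mx (djoin A B)) <= Ex (Mx A) * Ex (Mx B).
Proof.
apply: (@le_trans _ _ (Ex (fun x => Pr A B x x))).
  apply: Ex_le => x; apply/Mx_leP.
    by rewrite /Pr; apply: bigmax_ge_id.
  move=> t; rewrite inE => /exists_inP[r rA /exists_inP[s sB /andP[rs /eqP ->]]].
  rewrite /Xw (eq_bigl [predU r & s]) ?bigU //=; last by move=> i; rewrite !inE.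
  by rewrite /Pr (bigmax_sup (r, s)) //= rA sB.
apply: (@le_trans _ _ (Ex (fun x => Ex (Pr A B x)))); last first.
  rewrite -Ex_prod; apply: Ex_le => x; apply: Ex_le => y.
  apply/bigmax_leP; split; first by rewrite mulr_ge0 ?Mx_ge0.
  move=> [r s] /= /and3P[rA sB _].
  by apply: ler_pM; rewrite ?Xw_ge0 ?le_Mx.
apply: decouple => e x y k l.
pose Q (p : {set J} * {set J}) := [&& p.1 \in A, p.2 \in B & [disjoint p.1 & p.2]].
pose W (p : {set J} * {set J}) := Xw (p.1 :\ e) x * Xw (p.2 :\ e) y.
have W0 p : 0 <= W p by rewrite mulr_ge0 ?Xw_ge0.
pose a := \big[Num.max/0]_(p | Q p && (e \in p.1)) W p.
pose b := \big[Num.max/0]_(p | Q p && (e \in p.2)) W p.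
pose c := \big[Num.max/0]_(p | Q p && ((e \notin p.1) && (e \notin p.2))) W p.
have a0 : 0 <= a by apply: bigmax_ge_id.
have b0 : 0 <= b by apply: bigmax_ge_id.
have Qd p : Q p -> e \in p.1 -> e \in p.2 -> False.
  by move=> /and3P[_ _ /pred0P /(_ e)] /= + e1 e2; rewrite e1 e2.
have PrE u v : Pr A B (upd x e u) (upd y e v) =
    Num.max (Num.max (a * phi u) (b * phi v)) c.
  apply/eqP; rewrite eq_le; apply/andP; split.
    apply/bigmax_leP; split=> [|p Qp].
      by rewrite !le_max mulr_ge0 // ltW.
    rewrite !Xw_upd mulrACA -/(W p).
    have [e1|e1] := boolP (e \in p.1); have [e2|e2] := boolP (e \in p.2).
    - by case: (Qd p Qp e1 e2).
    - rewrite mulr1 mulrC !le_max ler_pM2r // (_ : W p <= a) //.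
      by rewrite /a (bigmax_sup p) // e1 andbT.
    - rewrite mul1r mulrC !le_max [X in _ || X || _]ler_pM2r //.
      rewrite (_ : W p <= b) ?orbT //.
      by rewrite /b (bigmax_sup p) // e2 andbT.
    - rewrite !mul1r !le_max (_ : W p <= c) ?orbT //.
      by rewrite /c (bigmax_sup p) // e1 e2 !andbT.
  have H p : Q p -> (if e \in p.1 then phi u else 1) *
      (if e \in p.2 then phi v else 1) * W p <= Pr A B (upd x e u) (upd y e v).
    move=> Qp; rewrite /W mulrACA -!Xw_upd.
    by rewrite /Pr (bigmax_sup p).
  have Pr0 : 0 <= Pr A B (upd x e u) (upd y e v) by apply: bigmax_ge_id.
  rewrite !ge_max; apply/andP; split; first (apply/andP; split).
  - rewrite -ler_pdivlMr //; apply/bigmax_leP; split=> [|p /andP[Qp e1]].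
      by rewrite divr_ge0 // ltW.
    rewrite ler_pdivlMr // mulrC; have := H p Qp; rewrite e1.
    by case: ifP => [/(Qd p Qp e1)//|_]; rewrite mulr1.
  - rewrite -ler_pdivlMr //; apply/bigmax_leP; split=> [|p /andP[Qp e2]].
      by rewrite divr_ge0 // ltW.
    rewrite ler_pdivlMr // mulrC; have := H p Qp; rewrite e2.
    by case: ifP => [e1|_]; [case: (Qd p Qp e1 e2)|rewrite mul1r].
  - apply/bigmax_leP; split=> // p /andP[Qp /andP[/negbTE e1 /negbTE e2]].
    by have := H p Qp; rewrite e1 e2 !mul1r.
rewrite !PrE.
have := phi_gt0 k; have := phi_gt0 l; set u := phi l; set v := phi k => u0 v0.
have [ab|ba] := leP a b.
  have -> : Num.max (a * v) (b * v) = b * v by apply/max_idPr; nra.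
  have -> : Num.max (a * u) (b * u) = b * u by apply/max_idPr; nra.
  rewrite addrC; apply: lerD; rewrite ge_max !le_max !lexx ?orbT //.
have -> : Num.max (a * v) (b * v) = a * v by apply/max_idPl; nra.
have -> : Num.max (a * u) (b * u) = a * u by apply/max_idPl; nra.
by apply: lerD; rewrite ge_max !le_max !lexx ?orbT.
Qed.

Section Chains.
Variables (Y : Type) (A : Y -> Y -> {set {set J}}) (succ : Y -> seq Y).
Variable stop : pred Y.

Fixpoint chains (k : nat) (y : Y) : {set {set J}} :=
  if k is k'.+1 then
    if stop y then [set finset.set0]%SET
    else (\bigcup_(y' <- succ y) djoin (A y y') (chains k' y'))%SET
  else [set finset.set0]%SET.

(** [B] is a supersolution of the one-step recursion: a maximum over a union is at most the sum of
    the maxima, and [Mx_bk] splits off the first link. *)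
Lemma Ex_chains (B : nat -> Y -> R) :
  (forall y, 1 <= B 0%N y) -> (forall k y, 0 <= B k y) ->
  (forall k y, stop y -> 1 <= B k y) ->
  (forall k y, ~~ stop y ->
     \sum_(y' <- succ y) Ex (Mx (A y y')) * B k y' <= B k.+1 y) ->
  forall k y, Ex (Mx (chains k y)) <= B k y.
Proof.
move=> B0 Bge0 Bstop Bstep.
have one y k : 1 <= B k y -> Ex (Mx [set finset.set0]%SET) <= B k y.
  move=> B1; rewrite -(Ex_cst (B k y)); apply: Ex_le => c.
  apply/Mx_leP; first exact: le_trans B1.
  by move=> r; rewrite inE => /eqP ->; rewrite /Xw big_set0.
elim=> [|k IH] y /=; first exact: one.
case: ifP => [sy|/negbT sy]; first by apply: one; apply: Bstop.
apply: le_trans (Bstep k y sy).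
apply: (@le_trans _ _ (\sum_(y' <- succ y) Ex (Mx (djoin (A y y') (chains k y'))))).
  rewrite -Ex_sum; apply: Ex_le => c; apply/Mx_leP.
    by apply: sumr_ge0 => y' _; apply: Mx_ge0.
  move=> r; elim: (succ y) => [|y' s IHs]; first by rewrite big_nil inE.
  rewrite !big_cons inE => /orP[ry|/IHs rs].
    by rewrite (le_trans (le_Mx c ry)) // lerDl sumr_ge0 // => *; apply: Mx_ge0.
  by rewrite (le_trans rs) // lerDr Mx_ge0.
apply: ler_sum => y' _; apply: (le_trans (Mx_bk _ _)).
by rewrite ler_wpM2l // -(Ex_cst 0) Ex_le // => c; apply: Mx_ge0.
Qed.

End Chains.
End FiniteProduct.

(** * Real-valued probabilities and finite-valued observables *)

Section RealProbability.
Context {disp : measure_display} {Omega : measurableType disp} {R : realType}.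
Variable P : probability Omega R.

Definition pr (A : set Omega) : R := fine (P A).

Lemma prE A : measurable A -> (pr A)%:E = P A.
Proof. by move=> mA; rewrite fineK ?fin_num_measure. Qed.

Lemma pr_ge0 A : 0 <= pr A.
Proof. exact: fine_ge0. Qed.

Lemma pr_le1 A : measurable A -> pr A <= 1.
Proof. by move=> mA; rewrite -lee_fin prE // probability_le1. Qed.

Lemma le_pr A B : measurable A -> measurable B -> A `<=` B -> pr A <= pr B.
Proof. by move=> mA mB AB; rewrite -lee_fin !prE // le_measure ?inE. Qed.

Lemma prU_le A B : measurable A -> measurable B -> pr (A `|` B) <= pr A + pr B.
Proof.
move=> mA mB; rewrite -lee_fin EFinD !prE //; last exact: measurableU.
exact: measureU2.
Qed.

Lemma prU A B : measurable A -> measurable B -> A `&` B = set0 ->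
  pr (A `|` B) = pr A + pr B.
Proof.
move=> mA mB AB; apply: EFin_inj; rewrite EFinD !prE //; last exact: measurableU.
exact: measureU.
Qed.

Lemma prC A : measurable A -> pr (~` A) = 1 - pr A.
Proof.
move=> mA; apply: EFin_inj; rewrite EFinB !prE //; last exact: measurableC.
exact: probability_setC.
Qed.

Lemma prI_ge A B : measurable A -> measurable B -> pr A + pr B - 1 <= pr (A `&` B).
Proof.
move=> mA mB; have mAC := measurableC mA; have mBC := measurableC mB.
have := prU_le mAC mBC; rewrite -setCI !prC //; last exact: measurableI.
lra.
Qed.

Lemma pr_fiber (T : finType) (f : Omega -> T) (Q : pred T) :
  (forall t, measurable [set w | f w = t]) ->
  measurable [set w | Q (f w)] /\
  pr [set w | Q (f w)] = \sum_(t | Q t) pr [set w | f w = t].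
Proof.
move=> mf.
have H s : uniq s -> measurable [set w | f w \in s] /\
    pr [set w | f w \in s] = \sum_(t <- s) pr [set w | f w = t].
  elim: s => [_|t s IH /= /andP[ts /IH[ms IHs]]].
    rewrite big_nil (_ : [set w | _] = set0); first by rewrite /pr measure0.
    by apply/seteqP; split.
  have E : [set w | f w \in t :: s] = [set w | f w = t] `|` [set w | f w \in s].
    apply/seteqP; split=> w /=; rewrite inE; first by case/predU1P; tauto.
    by case=> [->|->]; rewrite ?eqxx ?orbT.
  rewrite E; split; first exact: measurableU.
  rewrite prU // ?big_cons ?IHs //.
  by apply/seteqP; split => w //= [->]; rewrite (negbTE ts).
have [] := H (enum Q) (enum_uniq Q).
rewrite big_enum /= => mQ <-.
by rewrite (_ : [set w | Q (f w)] = [set w | f w \in enum Q]) //;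
  apply/seteqP; split => w /=; rewrite mem_enum.
Qed.

End RealProbability.

(** * Rounding the weights to a finite grid *)

Section Quantiser.
Variables (R : realType) (eta : R) (N : nat).
Hypothesis eta_gt0 : 0 < eta.

(** Nonnegative weights are rounded down, and a last unbounded cell collects the large values to
    keep the alphabet finite. *)
Definition quant (t : R) : 'I_N.+1 := inord (minn (Num.truncn (t / eta)) N).

Definition cell (k : 'I_N.+1) : set R := [set t | quant t = k].

Lemma quantE t : quant t = minn (Num.truncn (t / eta)) N :> nat.
Proof. by rewrite inordK // ltnS geq_minr. Qed.

Lemma measurable_cell k : measurable (cell k).
Proof.
have mge j : measurable [set t : R | (j <= Num.truncn (t / eta))%N].
  case: j => [|j].
    by rewrite (_ : [set t | _] = setT) //; apply/seteqP; split.
  rewrite (_ : [set t | _] = `[j.+1%:R * eta, +oo[%classic) //.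
  by apply/seteqP; split => t /=; rewrite truncn_gt_nat ler_pdivlMr // in_itv /= andbT.
have -> : cell k = if (k < N)%N then
    [set t | (k <= Num.truncn (t / eta))%N] `\` [set t | (k < Num.truncn (t / eta))%N]
    else [set t | (k <= Num.truncn (t / eta))%N].
  apply/seteqP; split => t; rewrite /cell /=.
    move/(congr1 val); rewrite /= quantE => tk.
    by case: ifPn => kN /=; [split; last apply/negP|]; move: tk; set n := Num.truncn _; lia.
  move=> H; apply/val_inj; rewrite /= quantE; move: H.
  by have := ltn_ord k; case: ifPn => kN /=; [move=> _ [+ /negP]|]; set n := Num.truncn _; lia.
by case: ifP => _ //; apply: measurableD.
Qed.

Lemma quant_le t : 0 <= t -> eta * (quant t)%:R <= t.
Proof.
move=> t0; rewrite mulrC -ler_pdivlMr // quantE.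
have /andP[h _] := truncn_itv (divr_ge0 t0 (ltW eta_gt0)).
by apply: le_trans h; rewrite ler_nat geq_minl.
Qed.

Lemma lt_quant t : 0 <= t -> (quant t < N)%N -> t <= eta * (quant t)%:R + eta.
Proof.
move=> t0 tN; have /andP[_ h] := truncn_itv (divr_ge0 t0 (ltW eta_gt0)).
rewrite -[X in _ + X]mulr1 -mulrDr mulrC -ler_pdivrMr //.
have -> : (quant t)%:R + 1 = (quant t).+1%:R :> R by rewrite -natr1.
suff -> : quant t = Num.truncn (t / eta) :> nat by rewrite ltW.
by move: tN; rewrite quantE; set n := Num.truncn _; move=> tN; apply/minn_idPl; lia.
Qed.

End Quantiser.

Section FiniteLaw.
Context {disp : measure_display} {Omega : measurableType disp} {R : realType}.
Context {P : probability Omega R} {I : choiceType}.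
Variables (tau : I -> {RV P >-> R}) (i0 : I) (eta : R) (N : nat).
Hypothesis eta_gt0 : 0 < eta.
Hypothesis tau_ge0 : forall i w, 0 <= tau i w.
Hypothesis tau_indep : mutually_independent tau.
Hypothesis tau_id : identically_distributed tau.

Definition qlaw (k : 'I_N.+1) : R := pr P (tau i0 @^-1` cell eta k).

Lemma measurable_tau i A : measurable A -> measurable (tau i @^-1` A).
Proof. by move=> mA; rewrite -[X in measurable X]setTI; apply: measurable_funP. Qed.

Lemma measurable_cost (s : seq I) (a : R) :
  measurable [set w | \sum_(e <- s) tau e w < a].
Proof.
have mf : measurable_fun setT (fun w => \sum_(e <- s) tau e w).
  by apply: measurable_sum.
have := mf measurableT _ (measurable_itv `]-oo, a[).
by rewrite setTI; congr measurable; apply/seteqP; split => w /=; rewrite in_itv.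
Qed.

Lemma pr_cell i k : pr P (tau i @^-1` cell eta k) = qlaw k.
Proof.
have := tau_id i i0 (measurable_cell eta_gt0 k).
by rewrite /distribution /pushforward /qlaw /pr => ->.
Qed.

Lemma qlaw_ge0 k : 0 <= qlaw k.
Proof. exact: pr_ge0. Qed.

Lemma qlaw_sum1 : \sum_k qlaw k = 1.
Proof.
have [_] := @pr_fiber _ _ _ P _ (fun w => quant eta N (tau i0 w)) predT
  (fun k => measurable_tau i0 (measurable_cell eta_gt0 k)).
move=> <-; rewrite (_ : [set w | _] = setT); last by apply/seteqP.
by rewrite /pr probability_setT.
Qed.

Section Config.
Variables (J : finType) (iota : J -> I).
Hypothesis iota_inj : injective iota.
Local Notation cfg := {ffun J -> 'I_N.+1}.

Definition conf (w : Omega) : cfg := [ffun e => quant eta N (tau (iota e) w)].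

Lemma pr_conf_eq (c : cfg) : measurable [set w | conf w = c] /\
  pr P [set w | conf w = c] = wt qlaw c.
Proof.
pose s := map iota (enum J).
pose A i : set R := if [pick e | iota e == i] is Some e then cell eta (c e) else setT.
have Ai e : A (iota e) = cell eta (c e).
  by rewrite /A; case: pickP => [e' /eqP/iota_inj ->//|/(_ e)]; rewrite eqxx.
have mA i : measurable (A i).
  by rewrite /A; case: pickP => // e _; apply: measurable_cell.
have us : uniq s by rewrite map_inj_uniq ?enum_uniq.
have E : [set w | conf w = c] = \bigcap_(i in [set` s]) tau i @^-1` A i.
  apply/seteqP; split => w /=.
    by move=> cw _ /= /mapP[e _ ->]; rewrite Ai -cw ffunE.
  move=> H; apply/ffunP => e; have := H (iota e); rewrite ffunE Ai; apply.
  by rewrite /= map_f ?mem_enum.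
have mE : measurable [set w | conf w = c].
  rewrite E; apply: fin_bigcap_measurable => [|i _]; first exact: finite_seq.
  exact: measurable_tau.
split=> //; apply: EFin_inj; rewrite prE // E tau_indep // /s big_map big_enum /=.
rewrite /wt -prodEFin; apply: eq_bigr => e _.
by rewrite Ai -(pr_cell (iota e)) prE //; apply: measurable_tau; apply: measurable_cell.
Qed.

Lemma measurable_conf (Q : pred cfg) : measurable [set w | Q (conf w)].
Proof. by have [] := pr_fiber P Q (fun c => (pr_conf_eq c).1). Qed.

Lemma pr_conf (Q : pred cfg) :
  pr P [set w | Q (conf w)] = Ex qlaw (fun c => (Q c)%:R).
Proof.
have [_ ->] := pr_fiber P Q (fun c => (pr_conf_eq c).1).
rewrite /Ex big_mkcond; apply: eq_bigr => c _.
by rewrite (pr_conf_eq c).2; case: (Q c); rewrite ?mulr1 ?mulr0.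
Qed.

Definition fcost (r : {set J}) (w : Omega) : R := \sum_(e in r) tau (iota e) w.

Definition qcost (r : {set J}) (c : cfg) : R := eta * \sum_(e in r) (c e)%:R.

Definition fcheap (A : {set {set J}}) (a : R) : set Omega :=
  [set w | exists2 r, r \in A & fcost r w < a].

Definition qcheap (A : {set {set J}}) (a : R) (c : cfg) : bool :=
  [exists r in A, qcost r c < a].

Lemma fcheap_sub A a w : fcheap A a w -> qcheap A a (conf w).
Proof.
move=> [r rA ra]; apply/exists_inP; exists r => //; apply: le_lt_trans ra.
rewrite /qcost mulr_sumr; apply: ler_sum => e _.
by rewrite ffunE quant_le.
Qed.

(** As [a <= N * eta], a set of rounded cost below [a] cannot meet the unbounded last cell, so each
    of its weights was lowered by at most [eta]. *)
Lemma qcheap_sub A a w : a <= N%:R * eta ->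
  qcheap A a (conf w) -> fcheap A (a + #|J|%:R * eta) w.
Proof.
move=> aN /exists_inP[r rA ra]; exists r => //.
have cN e : e \in r -> (conf w e < N)%N.
  move=> er; rewrite ltnNge; apply/negP => eN.
  have : a <= qcost r (conf w).
    apply: (le_trans aN); rewrite mulrC /qcost ler_pM2l //.
    rewrite (bigD1 e) //= -[leLHS]addr0 lerD ?ler_nat //.
    by apply: sumr_ge0 => *.
  by rewrite leNgt ra.
apply: (@le_lt_trans _ _ (qcost r (conf w) + #|r|%:R * eta)); last first.
  by apply: ltr_leD => //; rewrite ler_pM2r // ler_nat max_card.
rewrite /qcost mulr_sumr -sum1_card natr_sum mulr_suml -big_split /=.
apply: ler_sum => e er; rewrite mul1r.
by have := cN e er; rewrite ffunE => /lt_quant -> //.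
Qed.

Lemma measurable_fcheap A a : measurable (fcheap A a).
Proof.
have -> : fcheap A a = \bigcup_(r in [set r | r \in A]) [set w | fcost r w < a].
  by apply/seteqP; split => w [r rA ra]; exists r.
apply: fin_bigcup_measurable => [|r _]; first exact: finite_finset.
have := measurable_cost [seq iota e | e <- enum r] a; congr measurable.
by apply/seteqP; split => w /=; rewrite big_map big_enum.
Qed.

Lemma pr_fcheap_le A a : pr P (fcheap A a) <= Ex qlaw (fun c => (qcheap A a c)%:R).
Proof.
rewrite -pr_conf; apply: le_pr; [exact: measurable_fcheap|exact: measurable_conf|].
by move=> w; apply: fcheap_sub.
Qed.

Lemma pr_fcheap_ge A a : a <= N%:R * eta ->
  Ex qlaw (fun c => (qcheap A a c)%:R) <= pr P (fcheap A (a + #|J|%:R * eta)).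
Proof.
move=> aN; rewrite -pr_conf; apply: le_pr; [exact: measurable_conf|exact: measurable_fcheap|].
by move=> w; apply: qcheap_sub.
Qed.

End Config.
End FiniteLaw.

(** * Cheap members of a countable family of edge sets *)

Section Families.
Context {disp : measure_display} {Omega : measurableType disp} {R : realType}.
Context {P : probability Omega R} {I : countType}.
Variables (tau : I -> {RV P >-> R}) (i0 : I).
Hypothesis tau_ge0 : forall i w, 0 <= tau i w.
Hypothesis tau_indep : mutually_independent tau.
Hypothesis tau_id : identically_distributed tau.
Implicit Types (F G H : set (seq I)) (S : seq I) (a b : R).

(** The condition [uniq r] lets a list act as a finite set, whose cost counts every index once, as
    in [Xw]. *)
Definition cheap F a : set Omega :=
  [set w | exists r, [/\ F r, uniq r & \sum_(e <- r) tau e w < a]].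

Definition pcheap F a : R := pr P (cheap F a).

Definition restr S F : set (seq I) := [set r | F r /\ {subset r <= S}].

Lemma cost_subset (t r : seq I) w : uniq t -> {subset t <= r} ->
  \sum_(e <- t) tau e w <= \sum_(e <- r) tau e w.
Proof.
elim: t r => [|x t IH] r; first by rewrite big_nil => _ _; apply: sumr_ge0.
move=> /= /andP[xt ut] tr; have xr : x \in r by apply: tr; rewrite inE eqxx.
rewrite big_cons (perm_big _ (perm_to_rem xr)) /= big_cons lerD2l.
apply: IH => // y yt; have : y \in x :: rem x r.
  by rewrite -(perm_mem (perm_to_rem xr)) tr // inE yt orbT.
by rewrite inE => /predU1P[yx|//]; rewrite -yx yt in xt.
Qed.

Lemma measurable_cheap F a : measurable (cheap F a).
Proof.
have -> : cheap F a = \bigcup_(r : seq I)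
    (if `[< F r /\ uniq r >] then [set w | \sum_(e <- r) tau e w < a] else set0).
  apply/seteqP; split => w.
    by move=> [r [Fr ur ra]]; exists r => //; case: asboolP => //; case.
  by move=> [r _]; case: asboolP => // -[Fr ur] ra; exists r.
apply: countable_bigcupT_measurable => [|r]; first exact: countableP.
by case: ifP => _ //; apply: measurable_cost.
Qed.
Hint Resolve measurable_cheap : core.

Lemma pcheap_ge0 F a : 0 <= pcheap F a.
Proof. exact: pr_ge0. Qed.

Lemma pcheap_le1 F a : pcheap F a <= 1.
Proof. exact: pr_le1. Qed.

Lemma pcheap_cover F G a b : a <= b ->
  (forall r, F r -> uniq r -> exists t, [/\ G t, uniq t & {subset t <= r}]) ->
  pcheap F a <= pcheap G b.
Proof.
move=> ab FG; apply: le_pr => // w [r [Fr ur ra]].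
have [t [Gt ut tr]] := FG r Fr ur; exists t; split=> //.
by apply: le_lt_trans (lt_le_trans ra ab); apply: cost_subset.
Qed.

Lemma pcheap_mono F G a b : a <= b -> F `<=` G -> pcheap F a <= pcheap G b.
Proof. by move=> ab FG; apply: pcheap_cover => // r Fr ur; exists r; split=> //; apply: FG. Qed.

(** Continuity from below along an exhaustion of the countable index set. The bound holds for all
    larger [S'], so that several families can share one finite set. *)
Lemma pcheap_approx F a (delta : R) : 0 < delta ->
  exists S, forall S', {subset S <= S'} -> pcheap F a - delta <= pcheap (restr S' F) a.
Proof.
move=> d0.
pose S n := pmap (@unpickle I) (iota 0 n).
have Smono n m : (n <= m)%N -> {subset S n <= S m}.
  move=> nm x; rewrite /S -(subnKC nm) iotaD pmap_cat mem_cat => ->.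
  by [].
pose C n := cheap (restr (S n) F) a.
have CE : \bigcup_n C n = cheap F a.
  apply/seteqP; split => w; first by move=> [n _ [r [[Fr _] ur ra]]]; exists r.
  move=> [r [Fr ur ra]].
  have [n rn] : exists n, {subset r <= S n}.
    elim: (r) => [|x s [n IH]]; first by exists 0%N.
    exists (maxn n (pickle x).+1) => y; rewrite inE => /predU1P[->|/IH]; last first.
      by apply: Smono; rewrite leq_maxl.
    apply: (@Smono (pickle x).+1); first by rewrite leq_maxr.
    rewrite mem_pmap; apply/mapP; exists (pickle x); last by rewrite pickleK.
    by rewrite mem_iota leq0n add0n ltnS leqnn.
  by exists n => //; exists r.
have Cmono : {homo C : n m / (n <= m)%N >-> (n <= m)%O}.
  move=> n m nm; apply/subsetPset => w [r [[Fr rS] ur ra]]; exists r; split=> //.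
  by split=> // x /rS; apply: Smono.
have mC : measurable (\bigcup_n C n) by rewrite CE.
have : (fun n => P (C n)) @ \oo --> (pcheap F a)%:E.
  rewrite /pcheap prE // -CE.
  exact: (nondecreasing_cvg_mu (fun n => measurable_cheap _ _) mC Cmono).
move=> /fine_cvgP[_ /cvgrPdist_lt /(_ _ d0)].
move=> [n _ /(_ n (leqnn n))] /=; rewrite -/(pr P (C n)) => Hn.
exists (S n) => S' SS'; apply: (@le_trans _ _ (pr P (C n))).
  by have := ltW (le_lt_trans (ler_norm _) Hn); rewrite /pcheap; lra.
by apply: pcheap_mono => // r [Fr rS]; split=> // x /rS /SS'.
Qed.

Definition fam S F : {set {set seq_sub S}} :=
  [set r : {set seq_sub S} | `[< exists l, [/\ F l, uniq l & perm_eq l [seq ssval e | e <- enum (mem r)]] >]]%SET.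

Lemma cheap_restr S F a : cheap (restr S F) a = fcheap tau (@ssval _ S) (fam S F) a.
Proof.
apply/seteqP; split => w.
  move=> [r [[Fr rS] ur ra]].
  pose r' : {set seq_sub S} := [set e | ssval e \in r]%SET.
  have pr' : perm_eq r [seq ssval e | e <- enum r'].
    apply: uniq_perm => //.
      by rewrite map_inj_uniq ?enum_uniq //; apply: val_inj.
    move=> x; apply/idP/mapP => [xr|[e]]; last by rewrite mem_enum inE => ? ->.
    by exists (SeqSub (rS x xr)) => //; rewrite mem_enum inE.
  exists r'; first by rewrite inE; apply/asboolP; exists r.
  by move: ra; rewrite (perm_big _ pr') big_map big_enum.
move=> [r]; rewrite inE => /asboolP[l [Fl ul lr]]; rewrite /fcost => ra.
exists l; split=> //; last by rewrite (perm_big _ lr) big_map big_enum.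
by split=> // x; rewrite (perm_mem lr) => /mapP[e _ ->]; apply: ssvalP.
Qed.

Lemma quant_params (m : nat) (eta a : R) : 0 < eta ->
  exists (h : R) (N : nat), [/\ 0 < h, m%:R * h <= eta & a <= N%:R * h].
Proof.
move=> eta0; pose h := eta / m.+1%:R.
have h0 : 0 < h by rewrite divr_gt0.
exists h, (Num.truncn (a / h)).+1; split=> //.
  by rewrite /h mulrCA ler_piMr ?(ltW eta0) // ler_pdivrMr // mul1r ler_nat.
by rewrite -ler_pdivrMr // ltW // truncnS_gt.
Qed.

Lemma size_seq_sub S : (#|{: seq_sub S}| <= size S)%N.
Proof.
rewrite cardE -(size_map (@ssval _ S)) uniq_leq_size //.
  by rewrite map_inj_uniq ?enum_uniq //; apply: val_inj.
by move=> x /mapP[e _ ->]; apply: ssvalP.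
Qed.

Section Transfer.
Variables (S : seq I) (h : R) (N : nat).
Hypothesis h_gt0 : 0 < h.
Local Notation iota := (@ssval _ S).
Local Notation q := (qlaw tau i0 h (N := N)).
Local Notation qch F a := (fun c => (@qcheap R h N _ (fam S F) a c)%:R : R).

Lemma pcheap_restr_le F a : pcheap (restr S F) a <= Ex q (qch F a).
Proof.
rewrite /pcheap cheap_restr.
apply: pr_fcheap_le => //; exact: val_inj.
Qed.

Lemma Ex_qcheap_le F a b : a <= N%:R * h -> a + (size S)%:R * h <= b ->
  Ex q (qch F a) <= pcheap F b.
Proof.
move=> aN ab.
apply: le_trans (_ : pcheap (restr S F) (a + #|{: seq_sub S}|%:R * h) <= _).
  rewrite /pcheap cheap_restr; apply: pr_fcheap_ge => //; exact: val_inj.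
apply: pcheap_mono => [|r []//]; apply: le_trans ab.
rewrite lerD2l ler_pM2r // ler_nat.
exact: size_seq_sub.
Qed.

End Transfer.

End Families.

Section FamilyBounds.
Context {disp : measure_display} {Omega : measurableType disp} {R : realType}.
Context {P : probability Omega R} {I : countType}.
Variables (tau : I -> {RV P >-> R}) (i0 : I).
Hypothesis tau_ge0 : forall i w, 0 <= tau i w.
Hypothesis tau_indep : mutually_independent tau.
Hypothesis tau_id : identically_distributed tau.
Implicit Types (F G H : set (seq I)) (S : seq I) (a b : R).
Local Notation cheap := (cheap tau).
Local Notation pcheap := (pcheap tau).

Let iota_inj S : injective (@ssval _ S). Proof. exact: val_inj. Qed.

Lemma qcheap_cheap S (h : R) N F a b w : 0 < h -> a <= N%:R * h ->
  a + (size S)%:R * h <= b ->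
  qcheap h (fam S F) a (conf tau h N (@ssval _ S) w) -> cheap F b w.
Proof.
move=> h0 aN ab /(qcheap_sub h0 tau_ge0 aN); rewrite -cheap_restr => -[r [[Fr _] ur ra]].
exists r; split=> //; apply: lt_le_trans ra _; apply: le_trans ab.
by rewrite lerD2l ler_pM2r // ler_nat size_seq_sub.
Qed.

(** Invariance is read off the finite marginals: the rounded weights along [S] and along the image
    of [S] under [g] have the same product law. *)
Lemma pcheap_image (g : I -> I) F a (eta : R) : injective g -> 0 < eta ->
  pcheap F a <= pcheap [set [seq g e | e <- r] | r in F] (a + eta).
Proof.
move=> gi eta0; apply/ler_addgt0Pr => delta d0.
have [S HS] := pcheap_approx tau_ge0 F a d0.
have := HS S (fun _ => id).
have [h [N [h0 hS hN]]] := quant_params (size S) a eta0.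
rewrite lerBlDr => /le_trans; apply; rewrite lerD2r.
have gS : injective (g \o @ssval _ S) by apply: inj_comp.
apply: le_trans (pcheap_restr_le i0 tau_ge0 tau_indep tau_id S N h0 F a) _.
apply: le_trans (pr_fcheap_ge i0 h0 tau_ge0 tau_indep tau_id gS _ hN) _.
apply: le_pr; [exact: measurable_fcheap|exact: measurable_cheap|].
move=> w [r]; rewrite inE => /asboolP[l [Fl ul lr]] ra.
exists [seq g e | e <- l]; split; [by exists l|by rewrite map_inj_uniq|].
apply: lt_le_trans (_ : a + #|{: seq_sub S}|%:R * h <= _).
  move: ra; rewrite /fcost; congr (_ < _).
  by rewrite big_map (perm_big _ lr) big_map big_enum.
rewrite lerD2l; apply: le_trans hS; rewrite ler_pM2r // ler_nat.
exact: size_seq_sub.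
Qed.

Lemma qcheap_upd_le S (h : R) N F a c e (k l : 'I_N.+1) : 0 < h -> (k <= l)%N ->
  qcheap h (fam S F) a (upd c e l) -> qcheap h (fam S F) a (upd c e k).
Proof.
move=> h0 kl /exists_inP[r rF ra]; apply/exists_inP; exists r => //.
apply: le_lt_trans ra; rewrite /qcost ler_pM2l //; apply: ler_sum => i _.
by rewrite !ffunE; case: eqP => // _; rewrite ler_nat.
Qed.

(** Both events are decreasing in the weights. The rounding error is charged to [eta]; the
    truncation error [delta] is absent from the statement and can tend to 0. *)
Lemma pcheap_harris F G H a b (eta : R) : 0 < eta ->
  (forall r s, F r -> G s -> uniq r -> uniq s ->
     exists t, [/\ H t, uniq t & {subset t <= r ++ s}]) ->
  pcheap F a * pcheap G b <= pcheap H (a + b + eta).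
Proof.
move=> eta0 FGH; apply/ler_addgt0Pr => delta d0.
have d20 : 0 < delta / 2 by lra.
have [S1 H1] := pcheap_approx tau_ge0 F a d20.
have [S2 H2] := pcheap_approx tau_ge0 G b d20.
pose S := S1 ++ S2.
have {}H1 : pcheap F a - delta / 2 <= pcheap (restr S F) a.
  by apply: H1 => x xS; rewrite mem_cat xS.
have {}H2 : pcheap G b - delta / 2 <= pcheap (restr S G) b.
  by apply: H2 => x xS; rewrite mem_cat xS orbT.
suff Hle : pcheap (restr S F) a * pcheap (restr S G) b <= pcheap H (a + b + eta).
  have := pcheap_ge0 tau F a; have := pcheap_ge0 tau G b.
  have := pcheap_le1 tau F a; have := pcheap_le1 tau G b.
  have := pcheap_ge0 tau (restr S F) a; have := pcheap_ge0 tau (restr S G) b.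
  have := pcheap_le1 tau (restr S F) a; have := pcheap_le1 tau (restr S G) b.
  move: H1 H2 Hle; move: (pcheap F a) (pcheap G b) (pcheap H _)
    (pcheap (restr S F) a) (pcheap (restr S G) b) => f g x f' g' *.
  have : (f - delta / 2) * g <= f' * g by rewrite ler_wpM2r.
  have : f' * (g - delta / 2) <= f' * g' by rewrite ler_wpM2l.
  have : delta / 2 * g <= delta / 2 by rewrite ler_piMr // ltW.
  have : f' * (delta / 2) <= delta / 2 by rewrite ler_piMl // ltW.
  rewrite mulrBl mulrBr; lra.
have e20 : 0 < eta / 2 by lra.
have [h [N [h0 hS hN]]] := quant_params (size S) (Num.max a b) e20.
move: hN; rewrite ge_max => /andP[aN bN].
apply: (@le_trans _ _ (Ex (qlaw tau i0 h (N := N)) (fun c => (qcheap h (fam S F) a c)%:R) *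
                       Ex (qlaw tau i0 h (N := N)) (fun c => (qcheap h (fam S G) b c)%:R))).
  by apply: ler_pM; rewrite ?pcheap_ge0 //; apply: pcheap_restr_le.
apply: (@le_trans _ _ (Ex (qlaw tau i0 h (N := N))
    (fun c => (qcheap h (fam S F) a c && qcheap h (fam S G) b c)%:R))).
  under [in X in _ <= X]eq_fun do rewrite -mulnb natrM.
  apply: Ex_harris => [k||e k l]; first exact: qlaw_ge0.
    exact: qlaw_sum1.
  have mono F' a' (k' l' : 'I_N.+1) : (k' <= l')%N -> forall x,
    (qcheap h (fam S F') a' (upd x e l'))%:R <=
    (qcheap h (fam S F') a' (upd x e k'))%:R :> R.
    move=> kl x; have := @qcheap_upd_le S h N F' a' x e _ _ h0 kl.
    by do 2 case: (qcheap _ _ _ _) => //; rewrite ?ler01 // => /(_ isT).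
  by have [kl|lk] := leqP l k; [left|right; move/ltnW in lk]; split; apply: mono.
rewrite -(pr_conf i0 h0 tau_indep tau_id (iota_inj (S := S))).
apply: le_pr; [|exact: measurable_cheap|].
  exact: (measurable_conf i0 h0 tau_indep tau_id (iota_inj (S := S))
    (fun c => qcheap h (fam S F) a c && qcheap h (fam S G) b c)).
move=> w /andP[/(qcheap_cheap h0 aN (lexx _))[r [Fr ur ra]]].
move=> /(qcheap_cheap h0 bN (lexx _))[s [Gs us sb]].
have [t [Ht ut ts]] := FGH r s Fr Gs ur us; exists t; split=> //.
apply: le_lt_trans (cost_subset tau_ge0 w ut ts) _; rewrite big_cat /=.
apply: lt_le_trans (ltrD ra sb) _; lra.
Qed.

End FamilyBounds.

(** * Decoupling a crossing from the connections inside the boxes *)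

Section InsideOutside.
Context {disp : measure_display} {Omega : measurableType disp} {R : realType}.
Context {P : probability Omega R} {I : countType}.
Variables (tau : I -> {RV P >-> R}) (i0 : I).
Hypothesis tau_ge0 : forall i w, 0 <= tau i w.
Hypothesis tau_indep : mutually_independent tau.
Hypothesis tau_id : identically_distributed tau.
Local Notation cheap := (cheap tau).
Local Notation pcheap := (pcheap tau).

Let iota_inj S : injective (@ssval I S). Proof. exact: val_inj. Qed.

Lemma qcheap_upd_notin S (h : R) N (F : set (seq I)) a c (e : seq_sub S) (k : 'I_N.+1) :
  (forall r, F r -> ssval e \notin r) ->
  qcheap h (fam S F) a (upd c e k) = qcheap h (fam S F) a c.
Proof.
move=> Fe; rewrite /qcheap; apply: eq_existsb_in => r; rewrite inE.
move=> /asboolP[l [Fl ul lr]]; congr (_ * _ < _); apply: eq_bigr => i ir.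
rewrite ffunE; case: eqP => // ie; have := Fe l Fl; rewrite (perm_mem lr).
by rewrite -ie map_f // mem_enum.
Qed.

(** If several [Out v] are cheap, one [v] is selected by a rule that reads only indices outside [D].
    The selection is therefore independent of the weights in [D], where [In v] is cheap with good
    probability. Selections of different [v] are disjoint events, so no factor depending on the size
    of [V] is lost. *)
Lemma pcheap_inside_outside (V : finType) (Out In : V -> set (seq I)) (D : pred I)
    (H : set (seq I)) a b (eta : R) : 0 < eta ->
  (forall v r, Out v r -> {in r, forall e, ~~ D e}) ->
  (forall v r, In v r -> {in r, forall e, D e}) ->
  (forall v, 3/4 <= pcheap (In v) b) ->
  (forall v r s, Out v r -> In v s -> uniq r -> uniq s ->
     exists t, [/\ H t, uniq t & {subset t <= r ++ s}]) ->
  pcheap [set r | exists v, Out v r] a <= 2 * pcheap H (a + b + eta).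
Proof.
move=> eta0 OutD InD Inb OIH; apply/ler_addgt0Pr => delta d0.
have [S1 H1] := pcheap_approx tau_ge0 [set r | exists v, Out v r] a d0.
(* Truncation to finitely many indices may lower 3/4 by 1/4; the remaining 1/2 is the origin of the
   factor 2. *)
have quarter : 0 < 4^-1 :> R by rewrite invr_gt0.
have [S2 H2] := choice (fun v => pcheap_approx tau_ge0 (In v) b quarter).
pose S := S1 ++ flatten [seq S2 v | v <- enum V].
have {}H1 : pcheap [set r | exists v, Out v r] a - delta <=
            pcheap (restr S [set r | exists v, Out v r]) a.
  by apply: H1 => x xS; rewrite mem_cat xS.
have {}H2 v : 1/2 <= pcheap (restr S (In v)) b.
  apply: le_trans (H2 v S _); first by have := Inb v; lra.
  move=> x xS; rewrite mem_cat; apply/orP; right; apply/flattenP.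
  by exists (S2 v) => //; rewrite map_f ?mem_enum.
suff: pcheap (restr S [set r | exists v, Out v r]) a <= 2 * pcheap H (a + b + eta).
  by move: H1; lra.
have e20 : 0 < eta / 2 by lra.
have [h [N [h0 hS hN]]] := quant_params (size S) (Num.max a b) e20.
move: hN; rewrite ge_max => /andP[aN bN].
pose q := qlaw tau i0 h (N := N).
have q0 k : 0 <= q k by exact: qlaw_ge0.
have q1 : \sum_k q k = 1 by exact: qlaw_sum1.
pose qO v c := qcheap (N := N) h (fam S (Out v)) a c.
pose qI v c := qcheap (N := N) h (fam S (In v)) b c.
pose sel c := [pick v | qO v c].
have Esel : pcheap (restr S [set r | exists v, Out v r]) a <=
    \sum_v Ex q (fun c => (sel c == Some v)%:R).
  apply: (le_trans (pcheap_restr_le i0 tau_ge0 tau_indep tau_id S N h0 _ a)).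
  rewrite -Ex_sum; apply: Ex_le => // c.
  case Q : (qcheap _ _ _ _); last by apply: sumr_ge0.
  suff [v sv] : exists v, sel c = Some v.
    rewrite (bigD1 v) //= sv eqxx lerDl; exact: sumr_ge0.
  rewrite /sel; case: pickP => [v _|none]; first by exists v.
  move/exists_inP : Q => [r]; rewrite inE => /asboolP[l [[v Ol] ul lr]] ra.
  have rv : r \in fam S (Out v) by rewrite inE; apply/asboolP; exists l.
  by have /negbT/exists_inPn/(_ r rv) := none v; rewrite ra.
apply: (le_trans Esel).
have Emul v : Ex q (fun c => (sel c == Some v)%:R) <=
    2 * Ex q (fun c => ((sel c == Some v) && qI v c)%:R).
  have HI : 1/2 <= Ex q (fun c => (qI v c)%:R).
    exact: le_trans (H2 v) (pcheap_restr_le i0 tau_ge0 tau_indep tau_id S N h0 _ b).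
  have Hx : Ex q (fun c => (sel c == Some v)%:R) * Ex q (fun c => (qI v c)%:R) <=
      Ex q (fun c => ((sel c == Some v) && qI v c)%:R).
    under [in X in _ <= X]eq_fun do rewrite -mulnb natrM.
    apply: (@Ex_indep _ _ _ _ q0 q1 (fun e => D (ssval e))) => e x k De.
      congr ((_ == _)%:R); apply: eq_pick => u; apply: qcheap_upd_notin => r Or.
      by apply/negP => /(OutD u r Or); rewrite De.
    congr (nat_of_bool _)%:R; apply: qcheap_upd_notin => r Ir.
    by apply/negP => /(InD v r Ir); rewrite (negbTE De).
  have E0 : 0 <= Ex q (fun c => (sel c == Some v)%:R).
    by apply: sumr_ge0 => c _; rewrite mulr_ge0 ?wt_ge0.
  by move: HI Hx E0; move: (Ex q _) (Ex q _) (Ex q _) => x y z; nra.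
apply: (le_trans (ler_sum _ (fun v _ => Emul v))); rewrite -mulr_sumr ler_pM2l //.
rewrite -Ex_sum.
pose Q c := [exists v, qO v c && qI v c].
apply: (@le_trans _ _ (Ex q (fun c => (Q c)%:R))).
  apply: Ex_le => // c; case sc: (sel c) => [u|]; last by rewrite big1.
  rewrite (bigD1 u) //= eqxx big1 ?addr0 => [|v vu]; last first.
    by rewrite (_ : Some u == Some v = false) //; apply/eqP => -[uv]; rewrite uv eqxx in vu.
  case qu : (qI u c) => //; rewrite (_ : Q c = true) //.
  apply/existsP; exists u; rewrite qu andbT.
  by move: sc; rewrite /sel; case: pickP => // v + [<-].
rewrite -(pr_conf i0 h0 tau_indep tau_id (iota_inj (S := S))).
apply: le_pr; [|exact: measurable_cheap|].
  exact: (measurable_conf i0 h0 tau_indep tau_id (iota_inj (S := S)) Q).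
move=> w /existsP[v /andP[/(qcheap_cheap tau_ge0 h0 aN (lexx _))[r [Or ur ra]]]].
move=> /(qcheap_cheap tau_ge0 h0 bN (lexx _))[s [Is us sb]].
have [t [Ht ut ts]] := OIH v r s Or Is ur us; exists t; split=> //.
apply: le_lt_trans (cost_subset tau_ge0 w ut ts) _; rewrite big_cat /=.
apply: lt_le_trans (ltrD ra sb) _; lra.
Qed.

End InsideOutside.

(** * Exponential bound for chains of disjoint links *)

Section ChainBound.
Context {disp : measure_display} {Omega : measurableType disp} {R : realType}.
Context {P : probability Omega R} {I : countType}.
Variables (tau : I -> {RV P >-> R}) (i0 : I).
Hypothesis tau_ge0 : forall i w, 0 <= tau i w.
Hypothesis tau_indep : mutually_independent tau.
Hypothesis tau_id : identically_distributed tau.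
Local Notation pcheap := (pcheap tau).
Variables (Y : eqType) (A : Y -> Y -> set (seq I)) (succ : Y -> seq Y).
Variables (stop : pred Y).

Fixpoint ichains (k : nat) (y : Y) (r : seq I) : Prop :=
  if k is k'.+1 then
    if stop y then r = [::]
    else exists y' r1 r2,
      [/\ y' \in succ y, A y y' r1, ichains k' y' r2 & r = r1 ++ r2]
  else r = [::].

(** A concatenation without repetitions splits into disjoint sets, which turns consecutive links
    into disjoint occurrence. *)
Lemma fam_ichains S k y :
  {subset fam S (ichains k y) <= chains (fun y y' => fam S (A y y')) succ stop k y}.
Proof.
have nilE (r : {set seq_sub S}) : r \in fam S (fun r => r = [::]) -> r = finset.set0.
  rewrite inE => /asboolP[l [-> _ lr]].
  have : [seq ssval e | e <- enum r] = [::] by apply/nilP; rewrite /nilp -(perm_size lr).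
  case E : (enum r) => [|//] _; apply/setP => e.
  by rewrite [RHS]inE -mem_enum E.
elim: k y => [|k IH] y r /=; first by move=> /nilE ->; rewrite inE.
case: ifP => _; first by move=> /nilE ->; rewrite inE.
move=> rf; have {rf} : r \in fam S (fun r => exists y' r1 r2,
      [/\ y' \in succ y, A y y' r1, ichains k y' r2 & r = r1 ++ r2]) by [].
rewrite inE => /asboolP[l [[y' [r1 [r2 [ys Ar1 Cr2 ->]]]] ul lr]].
pose t1 : {set seq_sub S} := [set e in r | ssval e \in r1]%SET.
pose t2 : {set seq_sub S} := [set e in r | ssval e \in r2]%SET.
move: ul; rewrite cat_uniq => /and3P[u1 /hasPn d12 u2].
have permE (t : {set seq_sub S}) s : {subset s <= r1 ++ r2} -> uniq s ->
    t = [set e in r | ssval e \in s]%SET -> perm_eq s [seq ssval e | e <- enum t].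
  move=> sr us tE; apply: uniq_perm => //.
    by rewrite map_inj_uniq ?enum_uniq //; apply: val_inj.
  move=> x; apply/idP/mapP => [xs|[e]]; last by rewrite mem_enum tE inE => /andP[_ ?] ->.
  have := sr x xs; rewrite (perm_mem lr) => /mapP[e er xe]; exists e => //.
  by rewrite mem_enum tE inE -xe xs andbT -mem_enum.
have rj : r \in djoin (fam S (A y y'))
                  (chains (fun y y' => fam S (A y y')) succ stop k y').
  rewrite inE; apply/exists_inP; exists t1.
    rewrite inE; apply/asboolP; exists r1; split=> //; apply: permE => //.
    by move=> x xr; rewrite mem_cat xr.
  apply/exists_inP; exists t2.
    apply: IH; rewrite /= inE; apply/asboolP; exists r2; split=> //; apply: permE => //.
    by move=> x xr; rewrite mem_cat xr orbT.
  apply/andP; split.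
    apply/pred0P => e /=; apply/negP; rewrite !inE.
    by move=> /andP[/andP[_ e1] /andP[_ /d12]]; rewrite /= e1.
  apply/eqP/setP => e; rewrite !inE -andb_orr.
  case er : (e \in r) => //=; rewrite -mem_cat (perm_mem lr) map_f //.
  by rewrite mem_enum.
elim: (succ y) ys => // z s IHs; rewrite inE big_cons inE => /predU1P[<-|/IHs ->].
  by rewrite rj.
by rewrite orbT.
Qed.

(** Exponential Markov inequality for the minimal cost of a chain. The Laplace transform of one link
    is at most [expR (- lambda * b)] plus the probability of a cost below [b], with [b] the
    threshold [bb y y']. The common bound [bmax] allows one grid to resolve all thresholds. *)
Lemma pcheap_ichains (B : nat -> Y -> R) (lambda eta bmax : R) (bb : Y -> Y -> R) :
  0 < lambda -> 0 < eta -> (forall y y', bb y y' <= bmax) ->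
  (forall y, 1 <= B 0%N y) -> (forall k y, 0 <= B k y) ->
  (forall k y, stop y -> 1 <= B k y) ->
  (forall k y, ~~ stop y ->
     \sum_(y' <- succ y) (expR (- lambda * bb y y')
        + pcheap (A y y') (bb y y' + eta)) * B k y' <= B k.+1 y) ->
  forall k y a, pcheap (ichains k y) a <= expR (lambda * a) * B k y.
Proof.
move=> l0 eta0 bbmax B0 Bge0 Bstop Bstep k y a.
apply/ler_addgt0Pr => delta d0.
have [S HS] := pcheap_approx tau_ge0 (ichains k y) a d0.
have := HS S (fun _ => id); rewrite lerBlDr => /le_trans; apply; rewrite lerD2r.
have [h [N [h0 hS hN]]] := quant_params (size S) (Num.max a bmax) eta0.
move: hN; rewrite ge_max => /andP[aN bN].
pose q := qlaw tau i0 h (N := N).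
have q0 j : 0 <= q j by exact: qlaw_ge0.
have q1 : \sum_j q j = 1 by exact: qlaw_sum1.
pose phi (j : 'I_N.+1) : R := expR (- lambda * (h * j%:R)).
have phi0 j : 0 < phi j by exact: expR_gt0.
have XwE r c : Xw phi r c = expR (- lambda * qcost h r c).
  by rewrite /Xw -expR_sum /qcost !mulr_sumr.
apply: (le_trans (pcheap_restr_le i0 tau_ge0 tau_indep tau_id S N h0 _ a)).
apply: (@le_trans _ _ (Ex q (fun c => expR (lambda * a) *
    Mx phi (chains (fun y y' => fam S (A y y')) succ stop k y) c))).
  apply: Ex_le => // c; case Q : (qcheap _ _ _ _); last first.
    by rewrite mulr_ge0 ?expR_ge0 ?Mx_ge0.
  move/exists_inP : Q => [r rf ra].
  apply: (@le_trans _ _ (expR (lambda * a) * Xw phi r c)).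
    rewrite XwE -expRD -[leLHS]expR0 ler_expR mulNr -mulrBr mulr_ge0 ?ltW //.
    by rewrite subr_gt0.
  by rewrite ler_pM2l ?expR_gt0 // le_Mx //; apply: fam_ichains.
rewrite ExZ ler_pM2l ?expR_gt0 //.
apply: Ex_chains => // k' {HS}z nsz; apply: le_trans (Bstep k' z nsz).
apply: ler_sum => y' _; apply: ler_wpM2r => //.
apply: (@le_trans _ _ (Ex q (fun c => expR (- lambda * bb z y') +
    (qcheap h (fam S (A z y')) (bb z y') c)%:R))).
  apply: Ex_le => // c; apply/Mx_leP.
    by rewrite addr_ge0 ?expR_ge0.
  move=> r rf; rewrite XwE; have [rb|br] := ltP (qcost h r c) (bb z y').
    have -> : qcheap h (fam S (A z y')) (bb z y') c by apply/exists_inP; exists r.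
    rewrite -[leLHS]add0r; apply: lerD; rewrite ?expR_ge0 //.
    rewrite -[leRHS]expR0 ler_expR mulNr oppr_le0 mulr_ge0 ?(ltW l0) //.
    by rewrite /qcost mulr_ge0 ?(ltW h0) // sumr_ge0.
  by rewrite -[leLHS]addr0 lerD ?ler0n // ler_expR !mulNr lerN2 ler_pM2l.
rewrite ExD Ex_cst // lerD2l.
apply: Ex_qcheap_le => //; first by apply: le_trans bN.
by rewrite lerD2l.
Qed.

End ChainBound.

(** * Walks in a graph and loop erasure *)

Section Walk.
Variables (V E : eqType) (J : E -> V -> V -> bool).

Fixpoint walk (u v : V) (p : seq (E * V)) : bool :=
  if p is (e, w) :: p' then J e u w && walk w v p' else u == v.

Lemma walk_cat u v w p q : walk u v p -> walk v w q -> walk u w (p ++ q).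
Proof.
elim: p u => [|[e x] p IH] u /=; first by move=> /eqP ->.
by move=> /andP[-> /IH H] /H.
Qed.

Lemma walk_split u v x p : walk u v p -> x \in u :: unzip2 p ->
  exists p1 p2, [/\ p = p1 ++ p2, walk u x p1 & walk x v p2].
Proof.
elim: p u => [|[e w] p IH] u /=.
  by move=> /eqP <-; rewrite inE => /eqP ->; exists [::], [::]; rewrite /= eqxx.
move=> /andP[euw wp]; rewrite inE => /predU1P[->|xw].
  by exists [::], ((e, w) :: p); rewrite /= eqxx euw.
have [p1 [p2 [-> w1 w2]]] := IH w wp xw.
by exists ((e, w) :: p1), p2; rewrite /= euw.
Qed.

Lemma walk_last u v p : walk u v p -> v = last u (unzip2 p).
Proof. by elim: p u => [|[e w] p IH] u /=; [move/eqP | move=> /andP[_ /IH]]. Qed.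

Lemma walk_rev u v p : (forall e x y, J e x y -> J e y x) -> walk u v p ->
  exists q, walk v u q /\ unzip1 q = rev (unzip1 p).
Proof.
move=> Jsym; elim: p u => [|[e w] p IH] u /=.
  by move=> /eqP ->; exists [::]; rewrite /= eqxx.
move=> /andP[euw /IH[q [wq qp]]]; exists (q ++ [:: (e, u)]).
split; first by apply: walk_cat wq _; rewrite /= eqxx (Jsym _ _ _ euw).
by rewrite /unzip1 map_cat -/(unzip1 q) qp rev_cons cats1.
Qed.

Hypothesis J_ends : forall e u v u' v', J e u v -> J e u' v' -> u = u' \/ u = v'.

Lemma walk_edges_uniq u v p : walk u v p -> uniq (u :: unzip2 p) -> uniq (unzip1 p).
Proof.
elim: p u => [|[e w] p IH] u //= /andP[euw wp] /andP[unw uw].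
rewrite (IH w wp) // andbT; apply/negP => ep; move: unw; apply/negP; rewrite negbK.
have {uw} : exists x y, [/\ J e x y, x \in w :: unzip2 p & y \in w :: unzip2 p].
  elim: p w wp ep {IH euw uw} => [|[e' w'] p IH] w //= /andP[eww wp].
  rewrite inE => /predU1P[->|/(IH _ wp)[x [y [exy xp yp]]]].
    by exists w, w'; split=> //; rewrite !inE eqxx ?orbT.
  by exists x, y; split=> //; rewrite inE ?xp ?yp orbT.
by move=> [x [y [exy xp yp]]]; have [->|->] := J_ends euw exy.
Qed.

Lemma walk_erase u v p : walk u v p ->
  exists q, [/\ walk u v q, uniq (unzip1 q) & {subset q <= p}].
Proof.
move=> wp; suff [q [wq uq qp]] : exists q, [/\ walk u v q, uniq (u :: unzip2 q)
    & {subset q <= p}].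
  by exists q; split=> //; exact: walk_edges_uniq wq uq.
elim: p u wp => [|[e w] p IH] u /=.
  by move=> /eqP ->; exists [::]; rewrite /= eqxx.
move=> /andP[euw /IH[q [wq uq qp]]].
have [uin|unin] := boolP (u \in w :: unzip2 q); last first.
  exists ((e, w) :: q); split; [by rewrite /= euw|by rewrite cons_uniq unin|].
  by move=> x; rewrite !inE => /predU1P[->|/qp ->]; rewrite ?eqxx ?orbT.
have [q1 [q2 [qE w1 w2]]] := walk_split wq uin.
exists q2; split=> //; last first.
  by move=> x xq; rewrite inE qp ?orbT // qE mem_cat xq orbT.
move: uq; rewrite qE /unzip2 map_cat -cat_cons lastI cat_rcons cat_uniq.
by rewrite -(walk_last w1) => /and3P[].
Qed.

End Walk.

Lemma walk_map (V E V' E' : eqType) (J : E -> V -> V -> bool) (J' : E' -> V' -> V' -> bool)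
    (f : V -> V') (g : E -> E') u v p :
  (forall e x y, J e x y -> J' (g e) (f x) (f y)) -> walk J u v p ->
  walk J' (f u) (f v) [seq (g x.1, f x.2) | x <- p].
Proof.
move=> JJ; elim: p u => [|[e w] p IH] u /=; first by move=> /eqP ->; rewrite eqxx.
by move=> /andP[/JJ -> /IH].
Qed.

(* The edge of the quadrant joining (x, y) to (x + 1, y), respectively to
   (x, y + 1), is encoded by (false, (x, y)), respectively (true, (x, y)).
   The face [a - 1, a] x [b - 1, b] is the dual vertex (a, b); the dual
   vertices (a, 0) stand for the region below the x-axis. *)
Definition edge2 : Type := (bool * (nat * nat))%type.

Definition ends2 (e : edge2) : (nat * nat) * (nat * nat) :=
  let: (b, (x, y)) := e in ((x, y), if b then (x, y.+1) else (x.+1, y)).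

Definition joins2 (e : edge2) (u v : nat * nat) : bool :=
  (ends2 e == (u, v)) || (ends2 e == (v, u)).

Definition sides (e : edge2) : (nat * nat) * (nat * nat) :=
  let: (b, (x, y)) := e in (if b then (x, y.+1) else (x.+1, y), (x.+1, y.+1)).

Definition djoins (e : edge2) (u v : nat * nat) : bool :=
  (sides e == (u, v)) || (sides e == (v, u)).

Lemma joins2_ends e u v u' v' : joins2 e u v -> joins2 e u' v' -> u = u' \/ u = v'.
Proof.
by rewrite /joins2; case: (ends2 e) => a b /orP[]/eqP[? ?] /orP[]/eqP[? ?]; subst; tauto.
Qed.

Lemma djoins_ends e u v u' v' : djoins e u v -> djoins e u' v' -> u = u' \/ u = v'.
Proof.
by rewrite /djoins; case: (sides e) => a b /orP[]/eqP[? ?] /orP[]/eqP[? ?]; subst; tauto.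
Qed.

(** Telescoping modulo 2: in a row of vertices every edge is counted from both ends, except for the
    last one. *)
Lemma big_addb_shift (f : nat -> bool) n :
  \big[addb/false]_(x < n.+1) (f x (+) (if val x is x'.+1 then f x' else false)) = f n.
Proof.
elim: n => [|n IH]; first by rewrite big_ord1 addbF.
by rewrite big_ord_recr /= IH addbCA addbb addbF.
Qed.

(** * The contour of the region reached by closed dual walks *)

Section Contour.
Variables (closed : pred edge2) (m h : nat).
Hypotheses (m_gt0 : (0 < m)%N) (h_gt0 : (0 < h)%N).

(** These are the edges both sides of which are dual vertices [(a, b)] with [0 < a <= m] and
    [b <= h]; the edges on the bottom side belong to them, those on the lateral sides and on the top
    do not. *)
Definition interior2 (e : edge2) : bool :=
  let: (b, (x, y)) := e in
  if b then [&& 0 < x, x < m & y < h]%N else (x < m)%N && (y < h)%N.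

Definition reached (f : nat * nat) : bool :=
  [&& 0 < f.1, f.1 <= m & f.2 <= h]%N &&
  `[< exists k p, walk djoins f (k, 0)%N p /\
        all (fun e => closed e && interior2 e) (unzip1 p) >].

Definition contour (e : edge2) : bool := reached (sides e).1 (+) reached (sides e).2.

Lemma reached_bottom a : reached (a, 0)%N = (0 < a <= m)%N.
Proof.
rewrite /reached /=; case: (boolP (_ < _ <= _)%N) => am /=; last by rewrite andbA (negbTE am).
by rewrite andbA am /=; apply/asboolP; exists a, [::]; rewrite /= eqxx.
Qed.

Lemma reached_dom a b : reached (a, b) -> [&& 0 < a, a <= m & b <= h]%N.
Proof. by case/andP. Qed.

Lemma reached_step e u v : closed e -> interior2 e -> djoins e u v -> reached u -> reached v.
Proof.
move=> ce ie euv /andP[_ /asboolP[k [p [wp ap]]]]; apply/andP; split.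
  move: euv ie; rewrite /djoins; case: e {ce} => -[] [x y] /= /orP[]/eqP[? ?]; subst;
  rewrite /=; lia.
apply/asboolP; exists k, ((e, u) :: p); rewrite /= ce ie ap; split=> //.
by rewrite wp andbT; move: euv; rewrite /djoins orbC.
Qed.

Hypothesis reached_boundary : forall a b, reached (a, b) -> (0 < b)%N ->
  [&& a != 1, a != m & b != h]%N.

(** A contour edge outside the interior would border a reached face at a lateral side or at the top,
    against [reached_boundary]; a closed interior edge would let the dual walk pass to its other
    side. *)
Lemma contour_interior e : contour e -> interior2 e /\ ~~ closed e.
Proof.
move=> ce; have ie : interior2 e.
  move: ce; rewrite /contour; case: e => -[] [x y] /=.
    move=> H; have : reached (x, y.+1) \/ reached (x.+1, y.+1).
      by move: H; case: (reached (x, y.+1)) => //=; [left|right].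
    by move=> [] H1; have := reached_dom H1; have := reached_boundary H1 isT; lia.
  move=> H; have : reached (x.+1, y) \/ reached (x.+1, y.+1).
    by move: H; case: (reached (x.+1, y)) => //=; [left|right].
  move=> [] H1; have := reached_dom H1; have := reached_boundary H1; lia.
split=> //; apply/negP => cle; move: ce; rewrite /contour.
have d1 : djoins e (sides e).1 (sides e).2 by rewrite /djoins -surjective_pairing eqxx.
have d2 : djoins e (sides e).2 (sides e).1.
  by rewrite /djoins -surjective_pairing eqxx orbT.
have := reached_step cle ie d1; have := reached_step cle ie d2.
by case: (reached _) => /=; case: (reached _) => //= H1 H2; [have := H1 isT|have := H2 isT].
Qed.

(* Each vertex meets an even number of contour edges, except for the corners
   (0, 0) and (m, 0), which are therefore in the same contour component. *)
Lemma contour_walk : exists p, walk joins2 (0, 0)%N (m, 0)%N p /\ all contour (unzip1 p).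
Proof.
pose g v := `[< exists p, walk joins2 (0, 0)%N v p /\ all contour (unzip1 p) >].
apply/asboolP; rewrite -/(g (m, 0)%N); apply: contrapT => /negP gm.
have g0 : g (0, 0)%N by apply/asboolP; exists [::]; rewrite /= eqxx.
have gstep e u v : contour e -> joins2 e u v -> g u -> g v.
  move=> ce euv /asboolP[p [wp ap]]; apply/asboolP; exists (p ++ [:: (e, v)]).
  rewrite /unzip1 map_cat all_cat ap /= ce; split=> //.
  by apply: walk_cat wp _; rewrite /= euv eqxx.
have gE e u v : contour e -> joins2 e u v -> g u = g v.
  move=> ce euv; apply/idP/idP; apply: gstep ce _ => //.
  by move: euv; rewrite /joins2 orbC.
pose hor x y := contour (false, (x, y)); pose ver x y := contour (true, (x, y)).
have gh x y : g (x.+1, y) && hor x y = g (x, y) && hor x y.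
  case H : (hor x y); rewrite ?andbF // !andbT.
  by apply: gE H _; rewrite /joins2 /= eqxx orbT.
have gv x y : g (x, y.+1) && ver x y = g (x, y) && ver x y.
  case H : (ver x y); rewrite ?andbF // !andbT.
  by apply: gE H _; rewrite /joins2 /= eqxx orbT.
have ffl y : reached (0, y)%N = false by apply/negP => /reached_dom.
have ffr y : reached (m.+1, y) = false by apply/negP => /reached_dom; lia.
have fft x : reached (x, h.+1) = false by apply/negP => /reached_dom; lia.
pose A x y := g (x, y) && hor x y; pose B x y := g (x, y) && ver x y.
pose C x := g (x, 0)%N && (reached (x, 0)%N (+) reached (x.+1, 0)%N).
have key x y :
    (A x y (+) (if x is x'.+1 then A x' y else false)) (+)
    (B x y (+) (if y is y'.+1 then B x y' else false)) =
    if y is 0 then C x else false.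
  have -> : (if x is x'.+1 then A x' y else false) =
            g (x, y) && (reached (x, y) (+) reached (x, y.+1)).
    by case: x => [|x]; rewrite ?ffl ?andbF // -gh.
  have -> : (if y is y'.+1 then B x y' else false) =
            g (x, y) && (if y is y'.+1 then reached (x, y) (+) reached (x.+1, y) else false).
    by case: y => [|y]; rewrite ?andbF // -gv.
  rewrite /A /B /C; case: y => [|y]; case: (g (x, _)) => //=;
    rewrite /hor /ver /contour /=.
    by case: (reached (x, 0)%N); case: (reached (x.+1, 0)%N); case: (reached (x, 1)%N); case: (reached (x.+1, 1)%N).
  by case: (reached (x, y.+1)); case: (reached (x.+1, y.+1)); case: (reached (x, y.+2)); case: (reached (x.+1, y.+2)).
(* Handshake argument modulo 2 in the component of the origin: summed by edges the degrees cancel,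
   whereas summed by vertices only the bottom row remains, where [C] holds at the origin alone if
   [(m, 0)] lies outside the component. *)
have : \big[addb/false]_(y < h.+1) \big[addb/false]_(x < m.+1)
    ((A x y (+) (if val x is x'.+1 then A x' y else false)) (+)
    (B x y (+) (if val y is y'.+1 then B x y' else false))) = false.
  under eq_bigr => y _ do rewrite big_split /= big_addb_shift.
  rewrite big_split /= exchange_big /=.
  rewrite [X in X (+) _]big1 => [|y _]; last by rewrite /A /hor /contour /= !ffr andbF.
  under eq_bigr => x _ do rewrite big_addb_shift.
  by rewrite big1 // => x _; rewrite /B /ver /contour /= !fft andbF.
rewrite (eq_bigr (fun y : 'I_h.+1 => if val y is 0 then \big[addb/false]_(x < m.+1) C x
                                     else false)); last first.
  move=> y _; case: y => -[|y] /= Hy; last by rewrite big1 // => x _; rewrite key.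
  by apply: eq_bigr => x _; rewrite key.
rewrite (@big_ord_recl _ _ _ h) [X in _ (+) X]big1 //= addbF.
rewrite big_ord_recl big1 => [|x _].
  by rewrite /C g0 !reached_bottom /= m_gt0.
rewrite /C /= /bump /= add1n !reached_bottom; have := ltn_ord x.
rewrite leq_eqVlt => /predU1P[xm|xm]; first by rewrite xm (negbTE gm).
by case: (g _) => //=; lia.
Qed.

Let faces : seq (nat * nat) :=
  [seq f <- [seq (a, b) | a <- iota 1 m, b <- iota 1 h] | reached f].

(** For the length: a contour edge is one of the four sides of a reached face, or else one of the
    [m] edges on the bottom side. *)
Lemma contour_path : exists p, [/\ walk joins2 (0, 0)%N (m, 0)%N p, uniq (unzip1 p),
  {in unzip1 p, forall e, interior2 e /\ ~~ closed e} &
  (size p <= m + 4 * size faces)%N].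
Proof.
have [p [wp ap]] := contour_walk.
have [q [wq uq qp]] := walk_erase joins2_ends wp.
have cq : {in unzip1 q, forall e, contour e}.
  by move=> e /mapP[x xq ->]; apply: (allP ap); rewrite map_f ?qp.
exists q; split=> //; first by move=> e /cq /contour_interior.
pose around (f : nat * nat) : seq edge2 := [:: (true, (f.1.-1, f.2.-1)); (true, (f.1, f.2.-1));
  (false, (f.1.-1, f.2.-1)); (false, (f.1.-1, f.2))].
pose L := [seq (false, (x, 0)%N) | x <- iota 0 m] ++ flatten [seq around f | f <- faces].
have -> : (m + 4 * size faces)%N = size L.
  rewrite size_cat size_map size_iota; congr addn.
  by elim: faces => //= f s IH; rewrite -IH mulnS.
rewrite -(size_map fst); apply: uniq_leq_size => // e /cq ce.
have [ie _] := contour_interior ce.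
have inL f : reached f -> (0 < f.2)%N -> e \in around f -> e \in L.
  move=> fff f0 ef; rewrite mem_cat; apply/orP; right; apply/flattenP.
  exists (around f) => //; apply: map_f; rewrite mem_filter fff /=.
  case: f fff f0 {ef} => a b /reached_dom/and3P[a0 am bh] /= b0.
  by apply/allpairsP; exists (a, b); rewrite !mem_iota /=; split=> //; lia.
have : reached (sides e).1 || reached (sides e).2 by move: ce; rewrite /contour; case: (reached _).
case: e ce ie inL => -[] [x y] ce ie inL /=.
  by move=> /orP[] H; apply: (inL _ H); rewrite //= !inE eqxx ?orbT.
case: y ce ie inL => [|y] ce ie inL.
  move=> _; rewrite mem_cat map_f ?mem_iota //=.
  by move: ie => /=; lia.
by move=> /orP[] H; apply: (inL _ H); rewrite //= !inE eqxx ?orbT.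
Qed.

End Contour.

(** Coding dual walks by four directions makes their number explicit. On the axes the truncated
    predecessors may produce spurious steps, which only enlarges the set of codes. *)
Definition dstep (f : nat * nat) (c : bool * bool) : edge2 * (nat * nat) :=
  let: (a, b) := f in
  if c.1 then
    if c.2 then ((true, (a, b.-1)), (a.+1, b)) else ((true, (a.-1, b.-1)), (a.-1, b))
  else
    if c.2 then ((false, (a.-1, b)), (a, b.+1)) else ((false, (a.-1, b.-1)), (a, b.-1)).

Fixpoint dedges (f : nat * nat) (t : seq (bool * bool)) : seq edge2 :=
  if t is c :: t' then (dstep f c).1 :: dedges (dstep f c).2 t' else [::].

Lemma djoins_dstep e u v : djoins e u v -> exists c, dstep u c = (e, v).
Proof.
rewrite /djoins; case: e => -[] [x y] /= /orP[]/eqP[? ?]; subst.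
- by exists (true, true).
- by exists (true, false).
- by exists (false, true).
- by exists (false, false).
Qed.

Lemma walk_dedges u v p : walk djoins u v p ->
  exists t, size t = size p /\ dedges u t = unzip1 p.
Proof.
elim: p u => [|[e w] p IH] u /=; first by exists [::].
move=> /andP[/djoins_dstep[c uc] /IH[t [tp tE]]].
by exists (c :: t); rewrite /= uc tp tE.
Qed.

Lemma dedges_take f n t : dedges f (take n t) = take n (dedges f t).
Proof. by elim: t f n => [|c t IH] f [|n] //=; rewrite IH. Qed.

Lemma walk_djoins_height u v p : walk djoins u v p -> (u.2 <= v.2 + size p)%N.
Proof.
elim: p u => [|[e w] p IH] u /=; first by move=> /eqP ->; rewrite addn0.
move=> /andP[euw /IH H]; rewrite addnS.
suff u2 : (u.2 <= w.2.+1)%N by apply: leq_trans u2 _; rewrite ltnS.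
by move: euw; rewrite /djoins; case: e => -[] [x y] /= /orP[]/eqP[? ?]; subst => /=; lia.
Qed.

(** * A Peierls estimate for planar crossings *)

Section PlanarPercolation.
Context {disp : measure_display} {Omega : measurableType disp} {R : realType}.
Variable P : probability Omega R.

Lemma pr_bigU_le (T : Type) (s : seq T) (A : T -> set Omega) :
  (forall t, measurable (A t)) ->
  pr P (\big[setU/set0]_(t <- s) A t) <= \sum_(t <- s) pr P (A t).
Proof.
move=> mA; elim: s => [|t s IH]; first by rewrite !big_nil /pr measure0.
rewrite !big_cons; apply: le_trans (prU_le P (mA t) _) _.
  exact: bigsetU_measurable.
by rewrite lerD2l.
Qed.

(** Markov's inequality, reduced to a finite sum over the possible vectors of indicators. *)
Lemma pr_markov_sum (T : finType) (c : T -> R) (A : T -> set Omega) :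
  (forall t, 0 <= c t) -> (forall t, measurable (A t)) ->
  let B := [set w | 1 <= \sum_t c t * (`[< A t w >])%:R] in
  measurable B /\ pr P B <= \sum_t c t * pr P (A t).
Proof.
move=> c0 mA B.
pose f w : {ffun T -> bool} := [ffun t => `[< A t w >]].
have fE w t : f w t = `[< A t w >] by rewrite ffunE.
have mf v : measurable [set w | f w = v].
  have -> : [set w | f w = v] =
      \bigcap_(t in [set` enum T]) (if v t then A t else ~` A t).
    apply/seteqP; split => w /= H.
      by move=> t _; rewrite -H ffunE; case: asboolP.
    apply/ffunP => t; have := H t; rewrite /= mem_enum ffunE => /(_ isT).
    by case: asboolP => [At|nAt]; case: (v t).
  apply: fin_bigcap_measurable => [|t _]; first exact: finite_seq.
  by case: (v t) => //; apply: measurableC.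
pose Q (v : {ffun T -> bool}) := 1 <= \sum_t c t * (v t)%:R.
have BE : B = [set w | Q (f w)].
  have E w : \sum_t c t * (f w t)%:R = \sum_t c t * (`[< A t w >])%:R.
    by apply: eq_bigr => t _; rewrite fE.
  by apply/seteqP; split => w; rewrite /B /Q /= E.
have [mB pB] := pr_fiber P Q mf.
rewrite BE; split=> //; rewrite pB.
have AE t : pr P (A t) = \sum_(v : {ffun T -> bool} | v t) pr P [set w | f w = v].
  have [_ <-] := pr_fiber P (fun v : {ffun T -> bool} => v t) mf.
  by congr (pr P _); apply/seteqP; split => w /=; rewrite fE => /asboolP.
under [leRHS]eq_bigr do rewrite AE mulr_sumr.
rewrite (exchange_big_dep predT) //= big_mkcond; apply: ler_sum => v _.
rewrite -mulr_suml; case: ifP => [Qv|_]; last first.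
  by rewrite mulr_ge0 ?pr_ge0 // sumr_ge0.
rewrite -[leLHS]mul1r ler_wpM2r ?pr_ge0 //; apply: le_trans Qv _.
rewrite [leRHS]big_mkcond; apply: ler_sum => t _.
by case: (v t); rewrite ?mulr1 ?mulr0.
Qed.

Variables (Cl : edge2 -> set Omega) (p : R).
Hypotheses (mCl : forall e, measurable (Cl e)) (p_ge0 : 0 <= p).
Hypothesis Cl_le : forall s, uniq s -> pr P (\bigcap_(e in [set` s]) Cl e) <= p ^+ size s.

(** Codes that repeat an edge are discarded, since [Cl_le] bounds only the probability that distinct
    edges are closed. *)
Definition dual_open (f : nat * nat) (t : seq (bool * bool)) : set Omega :=
  if uniq (dedges f t) then \bigcap_(e in [set` dedges f t]) Cl e else set0.

Definition dual_reach (f : nat * nat) : set Omega :=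
  \big[setU/set0]_(t : f.2.-tuple (bool * bool)) dual_open f t.

Lemma size_dedges f t : size (dedges f t) = size t.
Proof. by elim: t f => //= c t IH f; rewrite IH. Qed.

Lemma measurable_dual_open f t : measurable (dual_open f t).
Proof.
rewrite /dual_open; case: ifP => // _.
by apply: fin_bigcap_measurable => //; apply: finite_seq.
Qed.

Lemma measurable_dual_reach f : measurable (dual_reach f).
Proof. by apply: bigsetU_measurable => t _; apply: measurable_dual_open. Qed.

Lemma pr_dual_reach f : pr P (dual_reach f) <= (4 * p) ^+ f.2.
Proof.
apply: le_trans (pr_bigU_le _ (fun t => measurable_dual_open _ _)) _.
apply: (@le_trans _ _ (\sum_(t : f.2.-tuple (bool * bool)) p ^+ f.2)).
  apply: ler_sum => t _; rewrite /dual_open; case: ifP => [ut|_].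
    by apply: le_trans (Cl_le ut) _; rewrite size_dedges size_tuple.
  by rewrite /pr measure0 exprn_ge0.
rewrite sumr_const card_tuple card_prod card_bool.
by rewrite -[leLHS]mulr_natl natrX -exprMn.
Qed.

(** A dual walk from height [f.2] down to the axis has at least [f.2] steps after loop erasure;
    cutting it to exactly that many leaves [4 ^ f.2] codes to sum over. *)
Lemma reached_dual_reach m h w f : reached (fun e => `[< Cl e w >]) m h f -> dual_reach f w.
Proof.
move=> /andP[_ /asboolP[k [q [wq aq]]]].
have [q' [wq' uq sub]] := walk_erase djoins_ends wq.
have [t [tq tE]] := walk_dedges wq'.
have := walk_djoins_height wq'; rewrite add0n -tq => sz.
have st : size (take f.2 t) == f.2 by rewrite size_takel.
rewrite /dual_reach (bigD1 (Tuple st)) //=; left.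
rewrite /dual_open dedges_take tE take_uniq // => e /= /mem_take /mapP[x xq ->].
by have /(allP aq)/andP[/asboolP] : x.1 \in unzip1 q by rewrite map_f ?sub.
Qed.

Lemma planar_crossing m h : p <= 1 / 8 -> (0 < m)%N -> (m <= 2 * h)%N ->
  exists B : set Omega, [/\ measurable B, pr P B <= 32 * p &
    forall w, ~ B w -> exists q, [/\ walk joins2 (0, 0)%N (m, 0)%N q, uniq (unzip1 q),
      {in unzip1 q, forall e, interior2 m h e /\ ~ Cl e w} & (size q <= 5 * m)%N]].
Proof.
move=> p8 m0 mh; have h0 : (0 < h)%N by lia.
pose T := ('I_m * 'I_h)%type; pose fT (t : T) := (t.1.+1, t.2.+1).
(* One weighted count controls all obstructions: if the weights of the reached faces sum to less
   than 1, none of these faces touches a lateral side or the top and there are fewer than [m] of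
   them, so that the contour has at most [m + 4 * m] edges. *)
pose c (t : T) : R := m%:R^-1 + (t.1.+1 == 1)%:R + (t.1.+1 == m)%:R + (t.2.+1 == h)%:R.
have c0 t : 0 <= c t by rewrite !addr_ge0 // invr_ge0.
have mG t := measurable_dual_reach (fT t).
have [mB pB] := pr_markov_sum c0 mG.
set B := [set w | _] in mB pB; exists B; split=> //.
  apply: le_trans pB _.
  (* Each of the four terms of [c] contributes at most [2 * r], which gives [8 * r = 32 * p] in
     total. *)
  have [r rE] : exists r, r = 4 * p by exists (4 * p).
  have r0 : 0 <= r by rewrite rE mulr_ge0.
  have r2 : r <= 1 / 2 by rewrite rE; move: p8; lra.
  apply: (@le_trans _ _ (\sum_t c t * r ^+ t.2.+1)).
    by apply: ler_sum => t _; rewrite ler_wpM2l // rE pr_dual_reach.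
  have geo n : \sum_(j < n) r ^+ j.+1 <= 2 * r - 2 * r ^+ n.+1.
    elim: n => [|n IH]; first by rewrite big_ord0 expr1; lra.
    rewrite big_ord_recr /=; have : 0 <= r ^+ n.+1 by rewrite exprn_ge0.
    have : r ^+ n.+2 = r * r ^+ n.+1 by rewrite exprS.
    move: IH; move: (\sum_(j < n) _) (r ^+ n.+1) (r ^+ n.+2) => x y z; nra.
  have geo' : \sum_(j < h) r ^+ j.+1 <= 2 * r.
    by apply: le_trans (geo h) _; rewrite gerBl mulr_ge0 ?exprn_ge0.
  rewrite -(pair_bigA _ (fun (i : 'I_m) (j : 'I_h) => c (i, j) * r ^+ j.+1)) /=.
  have cE (i : 'I_m) (j : 'I_h) : c (i, j) * r ^+ j.+1 =
     m%:R^-1 * r ^+ j.+1 + (i.+1 == 1)%:R * r ^+ j.+1 + (i.+1 == m)%:R * r ^+ j.+1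
     + (j.+1 == h)%:R * r ^+ j.+1 by rewrite /c /= !mulrDl.
  under eq_bigr => i _ do (under eq_bigr => j _ do rewrite cE;
    rewrite !big_split /= -!mulr_sumr).
  rewrite !big_split /= -!mulr_suml.
  set s := \sum_(j < h) r ^+ j.+1 in geo' *.
  have s0 : 0 <= s by apply: sumr_ge0 => *; rewrite exprn_ge0.
  have -> : \sum_(i < m) (m%:R^-1 : R) = 1.
    by rewrite sumr_const card_ord -[LHS]mulr_natl mulfV // pnatr_eq0; lia.
  have one k : \sum_(i < m) ((i.+1 == k)%:R : R) <= 1.
    have [km|km] := boolP ((0 < k <= m)%N); last first.
      by rewrite big1 // => i _; case: eqP => // ik; have := ltn_ord i; lia.
    have k1 : (k.-1 < m)%N by lia.
    rewrite (bigD1 (Ordinal k1)) //= big1 ?addr0 => [|i]; first by case: eqP.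
    rewrite -val_eqE /= => ik; case: eqP => // ik'; move: ik; rewrite -ik' /=.
    by rewrite eqxx.
  (* The top row has [m <= 2 * h] faces, each contributing [r ^+ h], and [h * r ^+ h.-1 <= 1]
     because [r <= 1 / 2]. *)
  have last : \sum_(i < m) \sum_(j < h) (j.+1 == h)%:R * r ^+ j.+1 <= 2 * r.
    have -> : \sum_(j < h) (j.+1 == h)%:R * r ^+ j.+1 = r ^+ h.
      have h1 : (h.-1 < h)%N by lia.
      rewrite (bigD1 (Ordinal h1)) //= prednK // eqxx mul1r big1 ?addr0 // => j.
      rewrite -val_eqE /= => jh; case: eqP => [jh'|_]; last by rewrite mul0r.
      by exfalso; move: jh jh'; lia.
    rewrite sumr_const card_ord -[leLHS]mulr_natl.
    apply: (@le_trans _ _ ((2 * h)%N%:R * r ^+ h)).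
      by rewrite ler_wpM2r ?exprn_ge0 // ler_nat.
    have H n : n.+1%:R * r ^+ n <= 1.
      elim: n => [|n IH]; first by rewrite mul1r.
      rewrite exprS; have r'0 : 0 <= r ^+ n by rewrite exprn_ge0.
      have : 1 <= n.+1%:R :> R by rewrite ler1n.
      have -> : n.+2%:R = n.+1%:R + 1 :> R by rewrite -natr1.
      move: IH r'0; move: (n.+1%:R : R) (r ^+ n) => x y; nra.
    have := H h.-1; rewrite prednK // => Hh.
    rewrite -(prednK h0) exprS prednK // natrM mulrACA.
    by rewrite -[leRHS]mulr1 ler_wpM2l // mulr_ge0.
  have := ler_wpM2r s0 (one 1%N); have := ler_wpM2r s0 (one m).
  move: last geo' rE; rewrite !mul1r /=; lra.
move=> w /negP; rewrite /B /= -ltNge => lt1.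
have G0 t : 1 <= c t -> ~ dual_reach (fT t) w.
  move=> ct Gt; move: lt1; apply/negP; rewrite -leNgt (bigD1 t) //=.
  rewrite (_ : `[< _ >]) ?mulr1; last exact/asboolP.
  by apply: le_trans ct _; rewrite lerDl sumr_ge0 // => *; rewrite mulr_ge0.
pose cl e := `[< Cl e w >].
have toT a b : reached cl m h (a, b) -> (0 < b)%N -> exists t, (a, b) = fT t.
  move=> /reached_dom/and3P[a0 am bh] b0.
  have a1 : (a.-1 < m)%N by lia.
  have b1 : (b.-1 < h)%N by lia.
  by exists (Ordinal a1, Ordinal b1); rewrite /fT /= !prednK.
have bd a b : reached cl m h (a, b) -> (0 < b)%N -> [&& a != 1, a != m & b != h]%N.
  move=> fab b0; have [t tE] := toT a b fab b0.
  have Gt := reached_dual_reach fab; rewrite tE in Gt.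
  have i0 : 0 <= m%:R^-1 :> R by rewrite invr_ge0.
  have ct : c t < 1 by rewrite ltNge; apply/negP => /G0.
  move: tE ct; rewrite /fT /c => -[-> ->].
  by case: (_ == _) => /=; case: (_ == _) => /=; case: (_ == _) => //=; lra.
have [q [wq uq iq sz]] := contour_path m0 h0 bd.
exists q; split=> //.
  by move=> e /iq[ie /negP nc]; split=> // Ce; apply: nc; apply/asboolP.
apply: leq_trans sz _; rewrite (mulnDl 1 4) mul1n leq_add2l leq_pmul2l //.
pose Q := [pred t : T | `[< dual_reach (fT t) w >]].
apply: (@leq_trans #|Q|).
  rewrite cardE -(size_map fT); apply: uniq_leq_size.
    rewrite filter_uniq // allpairs_uniq ?iota_uniq // => -[a b] [a' b'] _ _ /=.
    by move=> [-> ->].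
  move=> f; rewrite mem_filter => /andP[fff /allpairsP[[a b] /= [_ bi fE]]].
  rewrite fE in fff *; have b0 : (0 < b)%N by move: bi; rewrite mem_iota; lia.
  have [t tE] := toT a b fff b0; rewrite tE map_f // mem_enum inE.
  by have := reached_dual_reach fff; rewrite tE.
rewrite -(ler_nat R) -[leRHS]mul1r -ler_pdivrMr ?ltr0n //; apply: le_trans (ltW lt1).
rewrite mulrC -sum1_card natr_sum mulr_sumr big_mkcond /=; apply: ler_sum => t _.
rewrite mulr1 inE; case: asboolP => _ /=; last by rewrite mulr0.
by rewrite mulr1 /c -!addrA lerDl !addr_ge0.
Qed.

End PlanarPercolation.

(** * Lattice walks and the symmetries of the lattice *)

Section LatticeWalks.
Variable d : nat.
Local Notation V := (vertex d).
Local Notation E := (edge d).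
Implicit Types (x y u v : V) (e : E).

Lemma connectsE u v p : connects u v p = walk (@joins d) u v p.
Proof. by elim: p u => [|[e w] p IH] u //=; rewrite IH. Qed.

Lemma joins_sym e x y : joins e x y -> joins e y x.
Proof. by rewrite /joins => /orP[]/andP[-> ->]; rewrite ?orbT. Qed.

Lemma joins_ends e u v u' v' : joins e u v -> joins e u' v' -> u = u' \/ u = v'.
Proof.
by rewrite /joins => /orP[]/andP[/eqP-> _] /orP[]/andP[/eqP-> /eqP->]; tauto.
Qed.

Definition lat_paths (D : E -> Prop) u v : set (seq E) :=
  [set r | exists p, [/\ walk (@joins d) u v p, r = unzip1 p & {in r, forall e, D e}]].

Lemma lat_paths_cat (D D1 D2 : E -> Prop) u v w r s :
  (forall e, D1 e -> D e) -> (forall e, D2 e -> D e) ->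
  lat_paths D1 u v r -> lat_paths D2 v w s ->
  exists t, [/\ lat_paths D u w t, uniq t & {subset t <= r ++ s}].
Proof.
move=> D1D D2D [p [wp -> pD]] [q [wq -> qD]].
have [t [wt ut tpq]] := walk_erase joins_ends (walk_cat wp wq).
have sub : {subset unzip1 t <= unzip1 p ++ unzip1 q}.
  by move=> e /mapP[x /tpq xpq ->]; rewrite -map_cat map_f.
exists (unzip1 t); split=> //; exists t; split=> // e /sub.
by rewrite mem_cat => /orP[/pD/D1D|/qD/D2D].
Qed.

Lemma lat_paths_rev D u v r : lat_paths D u v r -> lat_paths D v u (rev r).
Proof.
move=> [p [wp -> pD]]; have [q [wq qE]] := walk_rev joins_sym wp.
by exists q; split=> // e; rewrite mem_rev => /pD.
Qed.

Definition trE (t : V) (e : E) : E := (e.1 + t, e.2).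

Lemma trE_inj t : injective (trE t).
Proof. by move=> [x i] [y j] [/addIr-> ->]. Qed.

Lemma joins_trE t e x y : joins e x y -> joins (trE t e) (x + t) (y + t).
Proof.
by rewrite /joins /edge_head /edge_tail /= => /orP[]/andP[/eqP-> /eqP->];
  rewrite ?(addrAC _ _ t) !eqxx ?orbT.
Qed.

Section SignedPermutation.
Variables (s : {perm 'I_d}) (sg : 'I_d -> bool).

Definition spV x : V := \row_j ((-1) ^+ sg j * x 0 (s j)).

(** An edge is coded by its lower end along its axis; when the sign of that axis is reversed, the
    image of the head becomes this lower end. *)
Definition spE e : E :=
  let k := (s^-1)%g e.2 in (if sg k then spV (edge_head e) else spV e.1, k).

Lemma spVD x y : spV (x + y) = spV x + spV y.
Proof. by apply/rowP => j; rewrite !mxE mulrDr. Qed.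

Lemma spVMn x n : spV (x *+ n) = spV x *+ n.
Proof.
elim: n => [|n IH]; last by rewrite !mulrS spVD IH.
by rewrite !mulr0n; apply/rowP => j; rewrite !mxE mulr0.
Qed.

Lemma spV_inj : injective spV.
Proof.
move=> x y /rowP xy; apply/rowP => j; have := xy ((s^-1)%g j).
by rewrite !mxE permKV => /(mulfI (negbT (signr_eq0 _ _))).
Qed.

Lemma spV_delta i : spV (delta_mx 0 i) =
  (-1) ^+ sg ((s^-1)%g i) *: delta_mx 0 ((s^-1)%g i).
Proof.
apply/rowP => j; rewrite !mxE eqxx /=.
case: (eqVneq j ((s^-1)%g i)) => [->|ji]; first by rewrite permKV eqxx.
by rewrite (_ : s j == i = false) ?mulr0 //; apply/eqP => sj; rewrite -sj permK eqxx in ji.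
Qed.

Lemma spE_inj : injective spE.
Proof.
move=> [x i] [y j] [+ /perm_inj ij]; rewrite ij /edge_head /=.
by case: (sg _) => [/spV_inj/addIr|/spV_inj] ->.
Qed.

Lemma joins_spE e x y : joins e x y -> joins (spE e) (spV x) (spV y).
Proof.
have H : spV (edge_head e) = spV (edge_tail e) +
    (-1) ^+ sg ((s^-1)%g e.2) *: delta_mx 0 ((s^-1)%g e.2).
  by rewrite /edge_head spVD spV_delta.
rewrite /joins {3 4}/edge_tail /edge_head /spE /=.
move=> /orP[]/andP[/eqP-> /eqP->]; move: H; case: (sg _);
  by rewrite ?expr1 ?expr0 ?scaleN1r ?scale1r => ->; rewrite ?subrK /edge_tail !eqxx ?orbT.
Qed.

End SignedPermutation.

Lemma basis_sum x : x = \sum_i (x 0 i) *: delta_mx 0 i.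
Proof. exact: row_sum_delta. Qed.

End LatticeWalks.

Section LatticePercolation.
Context {disp : measure_display} {Omega : measurableType disp} {R : realType}.
Context {P : probability Omega R} {d : nat}.
Variables (tau : edge d -> {RV P >-> R}) (i0 : edge d).
Hypothesis tau_ge0 : forall i w, 0 <= tau i w.
Hypothesis tau_indep : mutually_independent tau.
Hypothesis tau_id : identically_distributed tau.
Local Notation V := (vertex d).
Local Notation E := (edge d).
Local Notation pcheap := (pcheap tau).
Local Notation all_paths := (lat_paths (fun _ : E => True)).

Lemma pcheap_paths_image (f : V -> V) (g : E -> E) u v a (eta : R) :
  injective g -> (forall e x y, joins e x y -> joins (g e) (f x) (f y)) -> 0 < eta ->
  pcheap (all_paths u v) a <= pcheap (all_paths (f u) (f v)) (a + eta).
Proof.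
move=> gi gJ eta0.
apply: le_trans (pcheap_image i0 tau_ge0 tau_indep tau_id _ a gi eta0) _.
apply: pcheap_mono => // r [_ [p [wp -> _]] <-].
exists [seq (g x.1, f x.2) | x <- p]; split=> //; first exact: walk_map wp.
by rewrite /unzip1 -!map_comp.
Qed.

Lemma pcheap_paths_translate u v t a (eta : R) : 0 < eta ->
  pcheap (all_paths u v) a <= pcheap (all_paths (u + t) (v + t)) (a + eta).
Proof.
exact: (pcheap_paths_image (f := fun x => x + t) _ _ _ (@trE_inj d t) (@joins_trE d t)).
Qed.

Lemma pcheap_paths_triangle u v w a b (eta : R) : 0 < eta ->
  pcheap (all_paths u v) a * pcheap (all_paths v w) b <=
  pcheap (all_paths u w) (a + b + eta).
Proof.
move=> eta0; apply: pcheap_harris => // r s Fr Gs _ _.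
exact: lat_paths_cat Fr Gs.
Qed.

Lemma pcheap_lat_paths_refl (D : E -> Prop) u a : 0 < a ->
  1 <= pcheap (lat_paths D u u) a.
Proof.
move=> a0; apply: (@le_trans _ _ (pr P setT)); first by rewrite /pr probability_setT.
apply: le_pr; [exact: measurableT|exact: measurable_cheap|].
by move=> w _; exists [::]; split; rewrite ?big_nil //; exists [::]; rewrite /= eqxx.
Qed.

Lemma pcheap_cat (F G H : set (seq E)) a b :
  (forall r s, F r -> G s -> uniq r -> uniq s ->
     exists t, [/\ H t, uniq t & {subset t <= r ++ s}]) ->
  pcheap F a + pcheap G b - 1 <= pcheap H (a + b).
Proof.
move=> FGH; have mF := measurable_cheap tau F a; have mG := measurable_cheap tau G b.
apply: le_trans (prI_ge P mF mG) _; apply: le_pr => //; first exact: measurableI.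
  exact: measurable_cheap.
move=> w [[r [Fr ur ra]] [s [Gs us sb]]].
have [t [Ht ut ts]] := FGH r s Fr Gs ur us; exists t; split=> //.
apply: le_lt_trans (cost_subset tau_ge0 w ut ts) _; rewrite big_cat /=; exact: ltrD.
Qed.

(** The second alternative is the value 0 of [inf] on the empty set; connectedness of the lattice
    later excludes it. *)
Lemma passage_time_lt u v w a : (passage_time tau u v w < a) <->
  (exists2 p, connects u v p & path_time tau p w < a) \/
  ((forall p, ~ connects u v p) /\ 0 < a).
Proof.
pose S := [set path_time tau p w | p in [set p | connects u v p]].
have [[t [p wp pt]]|S0] := pselect (S !=set0); last first.
  have SE : S = set0 by apply/seteqP; split => // x Sx; case: S0; exists x.
  rewrite /passage_time -/S SE inf0; split.
    by move=> a0; right; split=> // p wp; apply: S0; exists (path_time tau p w); exists p.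
  by move=> [[p wp _]|[]//]; case: S0; exists (path_time tau p w); exists p.
split; last first.
  move=> [[q wq qa]|[/(_ p)]//]; apply: le_lt_trans qa; apply: ge_inf; last by exists q.
  by exists 0 => _ [r _ <-]; apply: sumr_ge0.
move=> /inf_lt[|_ [q wq <-] qa]; first by exists t; exists p.
by left; exists q.
Qed.

End LatticePercolation.

(** * Boxes and embedded quadrants *)

Section Boxes.
Variables (d n : nat).
Hypothesis n_gt0 : (0 < n)%N.
Local Notation V := (vertex d).
Local Notation E := (edge d).

Definition tile (v : V) : V := \row_i divz (v 0 i) n%:Z.

Definition inside (y : V) (e : E) : Prop :=
  tile (edge_tail e) = y /\ tile (edge_head e) = y.

Lemma tileP v y : tile v = y <->
  forall i, n%:Z * y 0 i <= v 0 i < n%:Z * y 0 i + n%:Z.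
Proof.
split=> [<- i|H].
  rewrite mxE; have := divz_eq (v 0 i) n%:Z; have n0 : n%:Z != 0 by lia.
  have := modz_ge0 (v 0 i) n0; have := ltz_mod (v 0 i) n0.
  move: (_ %/ _)%Z (_ %% _)%Z => q r; rewrite mulrC; lia.
apply/rowP => i; rewrite mxE; have /andP[h1 h2] := H i.
have n0 : n%:Z != 0 by lia.
have -> : v 0 i = y 0 i * n%:Z + (v 0 i - n%:Z * y 0 i) by ring.
rewrite divzMDl // divz_small ?addr0 //; move: (v 0 i) (y 0 i) h1 h2 => a b; lia.
Qed.

Lemma inside_joins y e u v : joins e u v -> tile u = y -> tile v = y -> inside y e.
Proof. by rewrite /inside /joins => /orP[]/andP[/eqP-> /eqP->]. Qed.

Lemma joins_inside y e u v : joins e u v -> inside y e -> tile u = y /\ tile v = y.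
Proof. by rewrite /inside /joins => /orP[]/andP[/eqP-> /eqP->] []. Qed.

End Boxes.

Section PlaneEmbedding.
Variable d : nat.
Local Notation V := (vertex d).
Local Notation E := (edge d).
Variables (u : V) (k j : 'I_d) (down : bool).
Hypothesis jk : j != k.

Definition plane (a : nat * nat) : V :=
  \row_i (u 0 i + (if i == k then a.1%:Z else 0)
          + (if i == j then (if down then - a.2%:Z else a.2%:Z) else 0)).

(** If the second axis is reversed, the code of a vertical edge is the image of its end farther from
    the first axis. *)
Definition plane_edge (e : edge2) : E :=
  let: (b, (x, y)) := e in
  if b then (plane (x, if down then y.+1 else y), j) else (plane (x, y), k).

Lemma plane_inj : injective plane.
Proof.
move=> [a b] [a' b'] /rowP H; have := H k; have := H j; rewrite !mxE !eqxx.
rewrite (negbTE jk) eq_sym (negbTE jk); case: down => /= H1 H2; congr pair; lia.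
Qed.

Lemma plane_edge_inj : injective plane_edge.
Proof.
move=> [b [x y]] [b' [x' y']] /=; case: b; case: b'.
- by move=> [/plane_inj[->]]; case: down => [[->]|->].
- by move=> [_ ji]; move: jk; rewrite ji eqxx.
- by move=> [_ ji]; move: jk; rewrite ji eqxx.
- by move=> [/plane_inj[-> ->]].
Qed.

Lemma joins_plane e a b : joins2 e a b -> joins (plane_edge e) (plane a) (plane b).
Proof.
have hE x y : plane (x.+1, y) = plane (x, y) + delta_mx 0 k.
  apply/rowP => i; rewrite !mxE eqxx /=; case: (eqVneq i k) => ik /=; last by rewrite !addr0.
  rewrite (_ : i == j = false) ?addr0; last by rewrite ik eq_sym (negbTE jk).
  lia.
have vE x y : plane (x, y.+1) =
    plane (x, y) + (if down then - delta_mx 0 j else delta_mx 0 j).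
  apply/rowP => i; rewrite !mxE; case: (down); rewrite !mxE eqxx /=;
  case: (eqVneq i j) => ij /=; rewrite ?oppr0 ?addr0 //; lia.
rewrite /joins2 /joins /edge_tail /edge_head; case: e => -[] [x y] /= /orP[]/eqP[<- <-] /=.
- by move: (vE x y); case: (down) => ->; rewrite ?subrK ?eqxx ?orbT.
- by move: (vE x y); case: (down) => ->; rewrite ?subrK ?eqxx ?orbT.
- by rewrite hE !eqxx.
- by rewrite hE !eqxx orbT.
Qed.

Lemma plane00 : plane (0, 0)%N = u.
Proof. by apply/rowP => i; rewrite mxE; case: down; rewrite ?oppr0 !if_same !addr0. Qed.

End PlaneEmbedding.

(** * Connections inside a box by fast edges *)

Section BoxCrossing.
Context {disp : measure_display} {Omega : measurableType disp} {R : realType}.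
Context {P : probability Omega R} {d : nat}.
Variables (tau : edge d -> {RV P >-> R}) (i0 : edge d).
Hypothesis tau_ge0 : forall i w, 0 <= tau i w.
Hypothesis tau_indep : mutually_independent tau.
Hypothesis tau_id : identically_distributed tau.
Local Notation V := (vertex d).
Local Notation E := (edge d).
Local Notation pcheap := (pcheap tau).

Definition slow (L : R) (e : E) : set Omega := tau e @^-1` `]L, +oo[.

Lemma measurable_slow L e : measurable (slow L e).
Proof. by apply: measurable_tau; apply: measurable_itv. Qed.

Lemma pr_slow L e : pr P (slow L e) = pr P (slow L i0).
Proof.
have := tau_id e i0 (measurable_itv `]L, +oo[).
by rewrite /distribution /pushforward /pr => ->.
Qed.

Lemma pr_slow_cap L (s : seq E) : uniq s ->
  pr P (\bigcap_(e in [set` s]) slow L e) = pr P (slow L i0) ^+ size s.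
Proof.
move=> us; have mE : measurable (\bigcap_(e in [set` s]) slow L e).
  by apply: fin_bigcap_measurable => [|e _]; [exact: finite_seq|exact: measurable_slow].
apply: EFin_inj; rewrite prE //.
rewrite (tau_indep (A := fun=> `]L, +oo[%classic) us) => [|e]; last exact: measurable_itv.
rewrite (eq_bigr (fun=> (pr P (slow L i0))%:E)) => [|e _]; last first.
  by rewrite -(pr_slow L e) prE //; apply: measurable_slow.
by rewrite prodEFin big_const_seq count_predT iter_mulr_1.
Qed.

(** Finiteness of the weight is enough: the events that it is at most [n] increase to the whole
    space. *)
Lemma pr_slow_small (p0 : R) : 0 < p0 -> exists2 L, 0 <= L & pr P (slow L i0) <= p0.
Proof.
move=> p00; pose C n : set Omega := tau i0 @^-1` `]-oo, n%:R].
have mC n : measurable (C n) by apply: measurable_tau; apply: measurable_itv.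
have CT : \bigcup_n C n = setT.
  apply/seteqP; split => // w _; exists (Num.truncn (tau i0 w)).+1 => //.
  by rewrite /C /= in_itv /= ltW // truncnS_gt.
have Cmono : {homo C : n m / (n <= m)%N >-> (n <= m)%O}.
  move=> n m nm; apply/subsetPset => w; rewrite /C /= !in_itv /= => /le_trans; apply.
  by rewrite ler_nat.
have mU : measurable (\bigcup_n C n) by rewrite CT.
have : (fun n => P (C n)) @ \oo --> 1%:E.
  by rewrite -(@probability_setT _ _ _ P) -CT; apply: nondecreasing_cvg_mu.
move=> /fine_cvgP[_ /cvgrPdist_lt /(_ _ p00)] [n _ /(_ n (leqnn n))] /= Hn.
exists n%:R => //; have -> : slow n%:R i0 = ~` C n.
  by apply/seteqP; split => w; rewrite /slow /C /= !in_itv /= andbT ltNge => /negP.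
rewrite prC //; apply: ltW; exact: le_lt_trans (ler_norm _) Hn.
Qed.

Variable L : R.
Hypothesis L_ge0 : 0 <= L.
Hypothesis slow_small : pr P (slow L i0) <= 1 / 8.
Local Notation p := (pr P (slow L i0)).

Lemma plane_crossing u k j down (m h : nat) (D : E -> Prop) : j != k ->
  (0 < m)%N -> (m <= 2 * h)%N ->
  (forall e, interior2 m h e -> D (plane_edge u k j down e)) ->
  1 - 32 * p <= pcheap (lat_paths D u (plane u k j down (m, 0)%N)) (5 * L * m%:R + 1).
Proof.
move=> jk m0 mh HD.
pose Cl e := slow L (plane_edge u k j down e).
have mCl e : measurable (Cl e) by apply: measurable_slow.
have ClE s : uniq s -> pr P (\bigcap_(e in [set` s]) Cl e) <= p ^+ size s.
  move=> us; have us' : uniq [seq plane_edge u k j down e | e <- s].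
    by rewrite map_inj_uniq //; apply: plane_edge_inj.
  rewrite -(size_map (plane_edge u k j down)) -pr_slow_cap //.
  rewrite (_ : \bigcap_(e in [set` s]) _ = 
    \bigcap_(e in [set` [seq plane_edge u k j down e | e <- s]]) slow L e) //.
  apply/seteqP; split => w H e /=; last by move=> es; apply: H; rewrite /= map_f.
  by move=> /mapP[e' es ->]; apply: H.
have [B [mB pB HB]] := planar_crossing mCl (pr_ge0 P _) ClE slow_small m0 mh.
apply: (@le_trans _ _ (pr P (~` B))); first by rewrite prC // lerD2l lerN2.
apply: le_pr; [exact: measurableC|exact: measurable_cheap|].
move=> w /HB[q [wq uq iq sz]].
exists [seq plane_edge u k j down e | e <- unzip1 q]; split.
- exists [seq (plane_edge u k j down x.1, plane u k j down x.2) | x <- q]; split.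
  + rewrite -{1}(plane00 u k j down); apply: walk_map wq => e a b.
    exact: joins_plane.
  + by rewrite /unzip1 -!map_comp.
  + by move=> _ /mapP[e /iq[ie _] ->]; apply: HD.
- by rewrite map_inj_uniq //; apply: plane_edge_inj.
rewrite big_map; apply: (@le_lt_trans _ _ (\sum_(e <- unzip1 q) L)).
  rewrite big_seq [leRHS]big_seq; apply: ler_sum => e /iq[_ nCe].
  rewrite leNgt; apply/negP => Lt; apply: nCe.
  by rewrite /Cl /slow /= in_itv /= Lt.
rewrite big_const_seq count_predT iter_addr addr0 size_map -[ltLHS]mulr_natr.
have -> : 5 * L * m%:R = L * (5 * m)%:R by rewrite natrM; ring.
by apply: le_lt_trans (ler_wpM2l L_ge0 _) (ltr_pwDr ltr01 (lexx _)); rewrite ler_nat.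
Qed.

End BoxCrossing.

Section BoxReach.
Context {disp : measure_display} {Omega : measurableType disp} {R : realType}.
Context {P : probability Omega R} {d : nat}.
Variables (tau : edge d -> {RV P >-> R}) (i0 : edge d).
Hypothesis tau_ge0 : forall i w, 0 <= tau i w.
Hypothesis tau_indep : mutually_independent tau.
Hypothesis tau_id : identically_distributed tau.
Hypothesis d_ge2 : (2 <= d)%N.
Variable n : nat.
Hypothesis n_gt0 : (0 < n)%N.
Variable L : R.
Hypothesis L_ge0 : 0 <= L.
Local Notation p := (pr P (slow tau L i0)).
Hypothesis slow_small : p <= 1 / 8.
Local Notation V := (vertex d).
Local Notation E := (edge d).
Local Notation pcheap := (pcheap tau).
Local Notation all_paths := (lat_paths (fun _ : E => True)).

(** One planar crossing per coordinate, of at most [5 * n] edges of weight at most [L]. The units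
    provide the strict inequalities that [cheap] asks for. *)
Definition reach_cost : R := d%:R * (5 * L * n%:R + 1) + 1.

(** The coordinates are corrected one at a time. From the lowest corner all displacements are in
    positive directions, and each is made in a planar rectangle that stays in the box. *)
Lemma box_reach y v : tile n v = y ->
  1 - d%:R * (32 * p) <= pcheap (lat_paths (inside n y) (y *+ n) v) reach_cost.
Proof.
move=> /(tileP n_gt0) vy.
pose pt (k : nat) : V := \row_i (if (i < k)%N then v 0 i else n%:Z * y 0 i).
have pt0 : y *+ n = pt 0%N.
  by apply/rowP => i; rewrite mulmxnE mxE /= -mulr_natl natz.
have ptd : v = pt d by apply/rowP => i; rewrite mxE ltn_ord.
have c0 : 0 <= 5 * L * n%:R :> R by rewrite !mulr_ge0.
have p0 := pr_ge0 P (slow tau L i0).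
suff H k : (k <= d)%N -> 1 - k%:R * (32 * p) <=
    pcheap (lat_paths (inside n y) (pt 0%N) (pt k)) (k%:R * (5 * L * n%:R + 1) + 1).
  by rewrite pt0 ptd; apply: H.
elim: k => [_|k IH kd].
  by rewrite !mul0r subr0 add0r pcheap_lat_paths_refl.
have {IH}IHk := IH (ltnW kd); pose ik := Ordinal kd.
pose m := absz (v 0 ik - n%:Z * y 0 ik)%R.
have vik := vy ik.
have mE : m%:Z = v 0 ik - n%:Z * y 0 ik by rewrite /m gez0_abs //; lia.
have mn : (m < n)%N by rewrite -ltz_nat mE; lia.
have [m_eq0|m_gt0] := posnP m.
  have -> : pt k.+1 = pt k.
    apply/rowP => i; rewrite !mxE ltnS leq_eqVlt orbC; case: ltnP => //= ki.
    case: eqP => // ik'; have -> : i = ik by apply/val_inj.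
    by move: mE; rewrite m_eq0 => /esym/eqP; rewrite subr_eq0 => /eqP.
  apply: le_trans (le_trans IHk _).
    by rewrite lerD2l lerN2 ler_wpM2r ?mulr_ge0 // ler_nat.
  apply: pcheap_mono => //; rewrite lerD2r ler_wpM2r ?addr_ge0 //.
  by rewrite ler_nat.
have [j jk] : exists j : 'I_d, j != ik.
  have d1 : (1 < d)%N by [].
  have d0 : (0 < d)%N by lia.
  case: (posnP k) => k0; [exists (Ordinal d1)|exists (Ordinal d0)];
    by rewrite -val_eqE /=; lia.
have ptj : n%:Z * y 0 j <= pt k 0 j < n%:Z * y 0 j + n%:Z.
  by rewrite mxE; case: ifP => _; [exact: vy|lia].
pose up := absz (n%:Z * y 0 j + n%:Z - 1 - pt k 0 j)%R.
pose lo := absz (pt k 0 j - n%:Z * y 0 j)%R.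
have upE : up%:Z = n%:Z * y 0 j + n%:Z - 1 - pt k 0 j by rewrite /up gez0_abs //; lia.
have loE : lo%:Z = pt k 0 j - n%:Z * y 0 j by rewrite /lo gez0_abs //; lia.
(* Since [up + lo = n - 1] and [m < n], one of the two half-planes leaves a height of at least half
   the length [m], as [planar_crossing] demands. *)
have [down [h [mh hE]]] : exists (down : bool) (h : nat), (m <= 2 * h)%N /\
    forall b, (b <= h)%N -> n%:Z * y 0 j <=
      pt k 0 j + (if down then - b%:Z else b%:Z) < n%:Z * y 0 j + n%:Z.
  case: (leqP m (2 * up)) => mu; [exists false, up|exists true, lo]; split=> //.
  - move=> b; lia.
  - lia.
  - move=> b; lia.
have inplane a b : (a <= m)%N -> (b <= h)%N -> tile n (plane (pt k) ik j down (a, b)) = y.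
  move=> am bh; apply/(tileP n_gt0) => i; rewrite mxE.
  case: (eqVneq i j) => [->|ij].
    by rewrite (negbTE jk) addr0; apply: hE.
  rewrite addr0; case: (eqVneq i ik) => [->|iik].
    by rewrite mxE ltnn /=; lia.
  rewrite addr0 mxE; case: ifP => _; first exact: vy.
  lia.
have Hin e : interior2 m h e -> inside n y (plane_edge (pt k) ik j down e).
  move=> ie; apply: (@inside_joins _ _ _ _ (plane (pt k) ik j down (ends2 e).1)
      (plane (pt k) ik j down (ends2 e).2)).
  - by apply: joins_plane => //; rewrite /joins2 -surjective_pairing eqxx.
  - by case: e ie => -[] [a b] /= ie; apply: inplane; lia.
  - by case: e ie => -[] [a b] /= ie; apply: inplane; lia.
have := plane_crossing tau_indep tau_id L_ge0 slow_small jk m_gt0 mh Hin.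
have -> : plane (pt k) ik j down (m, 0)%N = pt k.+1.
  apply/rowP => i; rewrite !mxE /=.
  rewrite (_ : (if i == j then _ else _) = 0) ?addr0; last first.
    by case: (down); rewrite ?oppr0 if_same.
  rewrite ltnS; case: (eqVneq i ik) => [->|iik].
    by rewrite /= leqnn ltnn mE; lia.
  rewrite addr0 (leq_eqVlt i k) (_ : (i == k :> nat) = false) //.
  by apply/negbTE.
move=> Hk; set b := 5 * L * m%:R + 1 in Hk.
set a := k%:R * _ + 1 in IHk.
have Hc : pcheap (lat_paths (inside n y) (pt 0%N) (pt k)) a +
    pcheap (lat_paths (inside n y) (pt k) (pt k.+1)) b - 1 <=
    pcheap (lat_paths (inside n y) (pt 0%N) (pt k.+1)) (a + b).
  by apply: pcheap_cat => // r s Fr Gs _ _; apply: lat_paths_cat Fr Gs.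
apply: le_trans (_ : _ <= pcheap (lat_paths (inside n y) (pt 0%N) (pt k.+1)) (a + b)) _.
  by move: IHk Hk Hc; rewrite -(natr1 k); lra.
apply: pcheap_mono => //; rewrite /a /b -(natr1 k).
have : 5 * L * m%:R <= 5 * L * n%:R by rewrite ler_wpM2l ?mulr_ge0 // ler_nat ltnW.
lra.
Qed.

(** Edges inside the two end boxes are forbidden, so that the crossing is independent of the
    connections inside these boxes. *)
Definition crossings (y y' : V) : set (seq E) :=
  [set r | exists v v', [/\ tile n v = y, tile n v' = y' &
     lat_paths (fun e => ~ inside n y e /\ ~ inside n y' e) v v' r]].

Let pos (y : V) (o : {ffun 'I_d -> 'I_n}) : V := \row_i (n%:Z * y 0 i + (o i : nat)%:Z).

(** Both ends of a crossing are joined to the corners of their boxes by inside edges. Each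
    connection succeeds with probability at least 7/8, hence both with probability at least 3/4, and
    [pcheap_inside_outside] applies with the pairs of possible ends as [V]. *)
Lemma crossings_le y y' a (eta : R) : y != y' -> d%:R * (32 * p) <= 1 / 8 -> 0 < eta ->
  pcheap (crossings y y') a <=
  2 * pcheap (all_paths 0 ((y' - y) *+ n)) (a + 2 * reach_cost + eta).
Proof.
move=> yy' p_small eta0; have e20 : 0 < eta / 2 by lra.
have tile_pos z o : tile n (pos z o) = z.
  by apply/(tileP n_gt0) => i; rewrite mxE; have := ltn_ord (o i); lia.
have pos_tile v : exists o, v = pos (tile n v) o.
  have /(tileP n_gt0) H := erefl (tile n v).
  have Hn i : (absz (v 0%R i - n%:Z * tile n v 0%R i)%R < n)%N by have := H i; lia.
  exists [ffun i => Ordinal (Hn i)]; apply/rowP => i; rewrite mxE ffunE /=.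
  by have Hi := H i; rewrite gez0_abs; move: Hi; lia.
pose T := ({ffun 'I_d -> 'I_n} * {ffun 'I_d -> 'I_n})%type.
pose Out (o : T) := lat_paths (fun e => ~ inside n y e /\ ~ inside n y' e)
                              (pos y o.1) (pos y' o.2).
pose In (o : T) : set (seq E) := [set t | exists r s, [/\ t = r ++ s,
  lat_paths (inside n y) (y *+ n) (pos y o.1) r &
  lat_paths (inside n y') (pos y' o.2) (y' *+ n) s]].
pose D e := `[< inside n y e \/ inside n y' e >].
have Hin o : 3 / 4 <= pcheap (In o) (2 * reach_cost).
  have H1 := box_reach (tile_pos y o.1); have H2 := box_reach (tile_pos y' o.2).
  have H2' : pcheap (lat_paths (inside n y') (y' *+ n) (pos y' o.2)) reach_cost <=
      pcheap (lat_paths (inside n y') (pos y' o.2) (y' *+ n)) reach_cost.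
    apply: pcheap_cover => // r /lat_paths_rev rr ur; exists (rev r).
    by rewrite rev_uniq; split=> // x; rewrite mem_rev.
  have Hc : pcheap (lat_paths (inside n y) (y *+ n) (pos y o.1)) reach_cost +
      pcheap (lat_paths (inside n y') (pos y' o.2) (y' *+ n)) reach_cost - 1 <=
      pcheap (In o) (reach_cost + reach_cost).
    apply: pcheap_cat => // r s Hr Hs ur us; exists (r ++ s); split=> //.
      by exists r, s.
    rewrite cat_uniq ur us andbT; apply/hasPn => e es; apply/negP => er.
    case: Hr Hs => [_ [_ _ /(_ e er) [ey _]]] [_ [_ _ /(_ e es) [ey' _]]].
    by move: yy'; rewrite -ey -ey' eqxx.
  rewrite (_ : 2 * reach_cost = reach_cost + reach_cost); last by ring.
  by move: H1 H2 H2' Hc p_small; lra.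
apply: (@le_trans _ _ (pcheap [set r | exists o, Out o r] a)).
  apply: pcheap_mono => // r [v [v' [vy vy' Hr]]].
  have [q vq] := pos_tile v; have [q' vq'] := pos_tile v'.
  by exists (q, q'); rewrite /Out /= -vy -vy' -vq -vq' vy vy'.
apply: le_trans (pcheap_inside_outside i0 tau_ge0 tau_indep tau_id
  (H := all_paths (y *+ n) (y' *+ n)) (D := D) (In := In) (b := 2 * reach_cost) a e20 _ _ Hin _) _.
- move=> o r [q [_ _ Hq]] e er; apply/asboolPn; by case: (Hq e er) => n1 n2; case.
- move=> o t [r [s [-> [q [_ _ Hq]] [q' [_ _ Hq']]]]] e.
  by rewrite mem_cat => /orP[/Hq|/Hq'] ?; apply/asboolP; [left|right].
- move=> o r t Or [r1 [s1 [-> Hr1 Hs1]]] _ _.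
  have [t1 [Ht1 _ sub1]] := lat_paths_cat (D := fun=> True) (fun _ _ => I) (fun _ _ => I) Hr1 Or.
  have [t2 [Ht2 u2 sub2]] := lat_paths_cat (D := fun=> True) (fun _ _ => I) (fun _ _ => I) Ht1 Hs1.
  exists t2; split=> // x /sub2; rewrite !mem_cat => /orP[/sub1|->]; rewrite ?orbT //.
  by rewrite mem_cat => /orP[] ->; rewrite ?orbT.
rewrite ler_pM2l //.
apply: le_trans (pcheap_paths_translate i0 tau_ge0 tau_indep tau_id _ _ (- (y *+ n)) _ e20) _.
rewrite subrr -mulrnBl; apply: pcheap_mono => //.
by rewrite -!addrA lerD2l lerD2l; lra.
Qed.

End BoxReach.

(** * The sup norm and the skeleton of a walk *)

Section SupNorm.
Variable d : nat.
Local Notation V := (vertex d).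

Definition linf (w : V) : nat := \max_(i < d) absz (w 0%R i).

Lemma linf_leP (w : V) k : (linf w <= k)%N <-> forall i, - k%:Z <= w 0 i <= k%:Z.
Proof.
split=> [/bigmax_leqP H i|H]; first by have := H i isT; lia.
by apply/bigmax_leqP => i _; have := H i; lia.
Qed.

Definition steps (k : nat) : seq V :=
  [seq w <- [seq \row_i ((f i : nat)%:Z - k%:Z) | f : {ffun 'I_d -> 'I_(2 * k).+1}]
     | linf w == k].

Lemma mem_steps k (w : V) : (w \in steps k) = (linf w == k).
Proof.
rewrite mem_filter andbC; case: eqP => [wk|]; rewrite ?andbF // andbT.
have /linf_leP H : (linf w <= k)%N by rewrite wk.
have Hf i : (absz (w 0%R i + k%:Z)%R < (2 * k).+1)%N by have := H i; lia.
apply/mapP; exists [ffun i => Ordinal (Hf i)]; first by rewrite mem_enum.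
apply/rowP => i; rewrite mxE ffunE /=; have := H i; lia.
Qed.

End SupNorm.

Lemma step_bound (K : nat) (a b c : int) : (0 < K)%N -> -1 <= a - c <= 1 ->
  - K.-1%:Z <= c - b <= K.-1%:Z -> - K%:Z <= a - b <= K%:Z.
Proof. lia. Qed.

Section Skeleton.
Variables (d n : nat).
Hypothesis n_gt0 : (0 < n)%N.
Local Notation V := (vertex d).
Local Notation E := (edge d).

Lemma tile_joins (e : E) (u v : V) i : joins e u v -> -1 <= tile n v 0 i - tile n u 0 i <= 1.
Proof.
move=> euv; have H : -1 <= v 0 i - u 0 i <= 1.
  move: euv; rewrite /joins /edge_head /edge_tail => /orP[]/andP[/eqP-> /eqP->];
  rewrite !mxE; case: (_ == _); case: (_ == _); rewrite ?mulr1n ?mulr0n /=; lia.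
have /(tileP n_gt0)/(_ i) := erefl (tile n u).
have /(tileP n_gt0)/(_ i) := erefl (tile n v).
move: H; move: (tile n u 0 i) (tile n v 0 i) (u 0 i) (v 0 i) => a b x y; nia.
Qed.

Variable K : nat.
Hypothesis K_gt0 : (0 < K)%N.
Variable yz : V.

Definition tile_succ (y : V) : seq V := [seq y + w | w <- steps d K].

Definition near_target (y : V) : bool := (linf (yz - y)%R < K)%N.

Lemma walk_first_exit (X : pred V) u z p : walk (@joins d) u z p -> ~~ X u -> X z ->
  exists p1 e v p2 x, [/\ p = p1 ++ (e, v) :: p2, walk (@joins d) u x p1,
    joins e x v, all (predC X) (u :: unzip2 p1) & X v /\ walk (@joins d) v z p2].
Proof.
elim: p u => [|[e w] p IH] u /=; first by move=> /eqP -> /negP.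
move=> /andP[euw wp] nXu Xz; have [Xw|nXw] := boolP (X w).
  by exists [::], e, w, p, u; rewrite /= nXu eqxx.
have [p1 [e' [v [p2 [x [-> w1 exv a1 [Xv w2]]]]]]] := IH w wp nXw Xz.
exists ((e, w) :: p1), e', v, p2, x; split=> //=; first by rewrite euw.
by rewrite nXu.
Qed.

Lemma walk_last_exit (X : pred V) u z p : walk (@joins d) u z p ->
  (exists p1 p2 x, [/\ p = p1 ++ p2, X x, walk (@joins d) u x p1,
    walk (@joins d) x z p2 & all (predC X) (unzip2 p2)]) \/
  all (predC X) (u :: unzip2 p).
Proof.
elim: p u => [|[e w] p IH] u /=.
  move=> /eqP ->; have [Xz|nXz] := boolP (X z); last by right.
  by left; exists [::], [::], z; rewrite /= eqxx.
move=> /andP[euw wp]; have [[p1 [p2 [x [-> Xx w1 w2 a2]]]]|aw] := IH w wp.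
  by left; exists ((e, w) :: p1), p2, x; split=> //=; rewrite euw.
have [Xu|nXu] := boolP (X u); last by right.
by left; exists [::], ((e, w) :: p), u; rewrite /= eqxx euw.
Qed.

Lemma walk_edge u v p e : walk (@joins d) u v p -> e \in unzip1 p ->
  exists a b, [/\ joins e a b, a \in belast u (unzip2 p) & b \in unzip2 p].
Proof.
elim: p u => [|[e' w] p IH] u //= /andP[euw wp]; rewrite inE => /predU1P[->|].
  by exists u, w; rewrite !inE !eqxx.
by move=> /(IH _ wp)[a [b [eab ain bin]]]; exists a, b; rewrite !inE ain bin !orbT.
Qed.

(** Let [v'] be the first vertex whose tile is at distance [K] from the initial one, and [u] the
    last vertex of the initial tile before it. After [u] the initial tile is not met again, and
    before [v'] its tile is not met at all, so the piece from [u] to [v'] is a crossing. The next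
    link starts at [v'], hence the links occupy successive parts of the walk. *)
Lemma skeleton k v z p : tile n z = yz -> walk (@joins d) v z p ->
  exists r, ichains (crossings n) tile_succ near_target k (tile n v) r /\
            subseq r (unzip1 p).
Proof.
move=> zE; elim: k v p => [|k IH] v p wp /=; first by exists [::]; rewrite sub0seq.
have [nt|nt] := boolP (near_target (tile n v)).
  by exists [::]; rewrite sub0seq.
pose X x := (K <= linf (tile n x - tile n v)%R)%N.
have nXv : ~~ X v.
  by rewrite /X subrr -ltnNge; apply: leq_ltn_trans K_gt0; apply/linf_leP => i; rewrite mxE.
have Xz : X z by rewrite /X zE leqNgt.
have [p1 [e [v' [p2 [x [pE w1 exv a1 [Xv' w2]]]]]]] := walk_first_exit wp nXv Xz.
have wv' : walk (@joins d) v v' (rcons p1 (e, v')).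
  by rewrite -cats1; apply: walk_cat w1 _; rewrite /= exv eqxx.
pose Y x := tile n x == tile n v.
have [[q1 [q2 [u [qE /eqP Yu wq1 wq2 a2]]]]|] := walk_last_exit Y wv'; last first.
  by rewrite /= /Y eqxx.
have nX a : a \in v :: unzip2 p1 -> ~~ X a by move=> H; exact: (allP a1 a H).
have xin : x \in v :: unzip2 p1 by rewrite (walk_last w1) mem_last.
(* The tiles of neighbours differ by at most 1 in each coordinate, so the distance [K] is not jumped
   over. *)
have wK : linf (tile n v' - tile n v) = K.
  apply/eqP; rewrite eqn_leq; apply/andP; split => //; apply/linf_leP => i.
  have /linf_leP/(_ i) : (linf (tile n x - tile n v)%R <= K.-1)%N.
    by have := nX x xin; rewrite /X -ltnNge; case: (K) K_gt0.
  have subE (a b : V) : (a - b) 0 i = a 0 i - b 0 i by rewrite !mxE.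
  rewrite !subE; have := tile_joins i exv; have := K_gt0.
  by move: (tile n v' 0 i) (tile n v 0 i) (tile n x 0 i) => A B C; apply: step_bound.
have [r2 [Cr2 sub2]] := IH v' p2 w2.
exists (unzip1 q2 ++ r2); split; last first.
  rewrite pE -cat_rcons qE /unzip1 map_cat; apply: cat_subseq => //.
  by rewrite map_cat suffix_subseq.
exists (tile n v'), (unzip1 q2), r2; split=> //.
  apply/mapP; exists (tile n v' - tile n v); first by rewrite mem_steps wK.
  by rewrite addrC subrK.
exists u, v'; split=> //; exists q2; split=> // e' e'q.
have [a [b [eab ain bin]]] := walk_edge wq2 e'q; split => ins.
  have [_ bE] := joins_inside eab ins.
  by have := allP a2 b bin; rewrite /= /Y bE eqxx.
have [aE _] := joins_inside eab ins.
have /nX : a \in v :: unzip2 p1.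
  rewrite -(belast_rcons v (unzip2 p1) v').
  have -> : rcons (unzip2 p1) v' = unzip2 q1 ++ unzip2 q2.
    by rewrite -map_cat -qE /unzip2 map_rcons.
  by rewrite belast_cat mem_cat -(walk_last wq1) ain orbT.
by rewrite /X aE -/(X v') Xv'.
Qed.

End Skeleton.

Lemma measurable_dist_ge (disp : measure_display) (Omega : measurableType disp) (R : realType)
    (f : Omega -> R) (c delta : R) :
  (forall a, measurable [set w | f w < a]) -> measurable [set w | delta <= `|f w - c|].
Proof.
move=> mf.
have -> : [set w | delta <= `|f w - c|] =
    (\bigcap_k [set w | f w < c - delta + k.+1%:R^-1]) `|` ~` [set w | f w < c + delta].
  apply/seteqP; split => w /=; rewrite ler_normr.
    move=> /orP[H|H]; [right|left]; first by apply/negP; rewrite -leNgt; lra.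
    move=> k _ /=; apply: (@le_lt_trans _ _ (c - delta)); first by lra.
    by rewrite ltrDl invr_gt0.
  move=> [H|/negP]; last by rewrite -leNgt => H; apply/orP; left; lra.
  apply/orP; right; suff : f w <= c - delta by lra.
  apply/ler_addgt0Pr => e e0; have := H (Num.truncn e^-1) I; move=> /= /ltW/le_trans; apply.
  by rewrite lerD2l invf_ple ?posrE // ltW // truncnS_gt.
apply: measurableU; last by apply: measurableC.
exact: bigcapT_measurable.
Qed.

Lemma vertex_ind (d : nat) (Q : vertex d -> Prop) : Q 0 ->
  (forall u v, Q u -> Q v -> Q (u + v)) ->
  (forall i, Q (delta_mx 0 i)) -> (forall i, Q (- delta_mx 0 i)) -> forall u, Q u.
Proof.
move=> Q0 QD Qp Qm u; rewrite (basis_sum u).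
apply: (big_ind Q) => // i _; case: (u 0 i) => n.
  elim: n => [|n IH]; first by rewrite scale0r.
  by rewrite -(addn1 n) PoszD scalerDl scale1r; apply: QD.
rewrite NegzE scaleNr; elim: n => [|n IH]; first by rewrite scale1r.
by rewrite -(addn1 n.+1) PoszD scalerDl scale1r opprD; apply: QD.
Qed.

Lemma lattice_connected (d : nat) (z : vertex d) : exists p, walk (@joins d) 0 z p.
Proof.
elim/vertex_ind: z => [|u v [p wp] [q wq]|i|i].
- by exists [::]; rewrite /= eqxx.
- have wq' := walk_map (f := fun x => x + u) (@joins_trE d u) wq.
  by rewrite add0r addrC in wq'; exists (p ++ [seq (trE u x.1, x.2 + u) | x <- q]);
    apply: walk_cat wp wq'.
- exists [:: ((0, i), delta_mx 0 i)].
  by rewrite /= eqxx /joins /edge_tail /edge_head /= add0r !eqxx.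
- exists [:: ((- delta_mx 0 i, i), - delta_mx 0 i)].
  by rewrite /= eqxx /joins /edge_tail /edge_head /= addNr !eqxx orbT.
Qed.

(** * The norm [nu] and its relation to the time constant *)

Section LimitNorm.
Context {disp : measure_display} {Omega : measurableType disp} {R : realType}.
Context {P : probability Omega R} {d : nat}.
Variables (tau : edge d -> {RV P >-> R}) (i0 : edge d).
Hypothesis tau_ge0 : forall i w, 0 <= tau i w.
Hypothesis tau_indep : mutually_independent tau.
Hypothesis tau_id : identically_distributed tau.
Hypothesis d_ge2 : (2 <= d)%N.
Local Notation V := (vertex d).
Local Notation E := (edge d).
Local Notation pcheap := (pcheap tau).
Local Notation all_paths := (lat_paths (fun _ : E => True)).

Lemma passage_timeE z a :
  [set w | passage_time tau 0 z w < a] = cheap tau (all_paths 0 z) a.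
Proof.
apply/seteqP; split => w /=.
  move=> /(passage_time_lt tau_ge0)[[p wp pa]|[none _]]; last first.
    by have [p wp] := lattice_connected z; case: (none p); rewrite connectsE.
  rewrite connectsE in wp; have [q [wq uq qp]] := walk_erase (@joins_ends d) wp.
  exists (unzip1 q); split=> //; first by exists q.
  apply: le_lt_trans pa; rewrite /path_time -(big_map fst predT (fun e => tau e w)).
  by apply: cost_subset => // e /mapP[x /qp xp ->]; rewrite map_f.
move=> [_ [[p [wp -> _]] _ pa]]; apply/(passage_time_lt tau_ge0); left.
exists p; first by rewrite connectsE.
by rewrite /path_time -(big_map fst predT (fun e => tau e w)).
Qed.

Lemma measurable_passage_time z a : measurable [set w | passage_time tau 0 z w < a].
Proof. by rewrite passage_timeE; apply: measurable_cheap. Qed.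

Variable L : R.
Hypothesis L_ge0 : 0 <= L.
Local Notation p := (pr P (slow tau L i0)).
Hypothesis p_small : d%:R * (32 * p) <= 1 / 8.

Lemma slow_le8 : p <= 1 / 8.
Proof.
have d1 : 1 <= d%:R :> R by rewrite ler1n; lia.
have := pr_ge0 P (slow tau L i0).
move: p_small d1; move: (pr P _) (d%:R : R) => x y H y1 x0.
have : x <= y * x by rewrite ler_peMl.
lra.
Qed.

Variable U : set_system nat.
Hypothesis U_ultra : UltraFilter U.
Hypothesis U_oo : \oo `<=` U.

(* The limit defining the time constant need not exist in every direction; the
   limit along an ultrafilter replaces it, and picks a scale that is good for
   finitely many directions at once. *)
Definition good (u : V) : set R := [set a | exists2 delta : R, 0 < delta &
  U [set n | delta <= pcheap (all_paths 0 (u *+ n)) (a * n%:R)]].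

Definition nu (u : V) : R := inf (good u).

Lemma U_ge (k : nat) : U [set n | (k <= n)%N].
Proof. by apply: U_oo; exists k. Qed.

Lemma good_mono u u' a a' : (forall n delta, (0 < n)%N ->
    delta <= pcheap (all_paths 0 (u *+ n)) (a * n%:R) ->
    delta <= pcheap (all_paths 0 (u' *+ n)) (a' * n%:R)) -> good u a -> good u' a'.
Proof.
move=> H [delta d0 Ud]; exists delta => //; apply: filterS (filterI (U_ge 1) Ud).
by move=> n [/= n0 Hn]; apply: H.
Qed.

Lemma good_up u a b : a <= b -> good u a -> good u b.
Proof.
move=> ab; apply: good_mono => n delta _ /le_trans; apply.
by apply: pcheap_mono => //; rewrite ler_wpM2r.
Qed.

Lemma good_gt0 u a : good u a -> 0 < a.
Proof.
move=> [delta d0 Ud]; have [n /= Hn] := filter_ex Ud.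
have : cheap tau (all_paths 0 (u *+ n)) (a * n%:R) !=set0.
  apply/set0P/eqP => E0; move: Hn; rewrite /pcheap E0 /pr measure0 /=; lra.
move=> [w [r [_ _ ra]]]; have : 0 < a * n%:R.
  by apply: le_lt_trans ra; apply: sumr_ge0.
by case: n {Hn ra} => [|n]; rewrite ?mulr0 ?ltxx // pmulr_lgt0.
Qed.

Lemma good_add u v a b (eta : R) : 0 < eta -> good u a -> good v b ->
  good (u + v) (a + b + eta).
Proof.
move=> eta0 [d1 d10 U1] [d2 d20 U2]; exists (d1 * d2); first exact: mulr_gt0.
apply: filterS (filterI (U_ge 1) (filterI U1 U2)) => n [/= n0 [/= H1 H2]].
have e20 : 0 < eta / 2 by lra.
have H2' := pcheap_paths_translate i0 tau_ge0 tau_indep tau_id 0 (v *+ n) (u *+ n) (b * n%:R) e20.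
have T := pcheap_paths_triangle i0 tau_ge0 tau_indep tau_id 0 (u *+ n) ((u + v) *+ n)
   (a * n%:R) (b * n%:R + eta / 2) e20.
have uvE : v *+ n + u *+ n = (u + v) *+ n by rewrite mulrnDl addrC.
rewrite add0r uvE in H2'.
apply: le_trans (_ : _ <= pcheap (all_paths 0 (u *+ n)) (a * n%:R) *
   pcheap (all_paths (u *+ n) ((u + v) *+ n)) (b * n%:R + eta / 2)) _.
  by apply: ler_pM => //; [exact: ltW|exact: ltW|exact: le_trans H2 H2'].
apply: le_trans T _; apply: pcheap_mono => //.
have : eta <= eta * n%:R by rewrite ler_peMr ?ler1n // ltW.
rewrite !mulrDl; lra.
Qed.

Lemma good_spV s sg u a (eta : R) : 0 < eta -> good u a -> good (spV s sg u) (a + eta).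
Proof.
move=> eta0; apply: good_mono => n delta n0 /le_trans; apply.
apply: le_trans (pcheap_paths_image i0 tau_ge0 tau_indep tau_id _ _ _ (@spE_inj d s sg)
   (@joins_spE d s sg) eta0) _.
rewrite spVMn (_ : spV s sg 0 = 0); last by rewrite -(mulr0n u) spVMn mulr0n.
apply: pcheap_mono => //; rewrite mulrDl lerD2l ler_peMr ?ler1n // ltW //.
Qed.

(** The point [n] times a basis vector lies in a box of side [n + 1], and
    [5 * L * (n + 1) <= 10 * L * n] for positive [n]. *)
Definition step_cost : R := d%:R * (10 * L + 1) + 1.

Lemma good_delta i : good (delta_mx 0 i) step_cost.
Proof.
exists (1 / 2); first by rewrite divr_gt0.
apply: filterS (U_ge 1) => n /= n0.
have tE : tile n.+1 (delta_mx 0 i *+ n : V) = 0.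
  apply/(tileP (ltn0Sn n)) => j; rewrite mulmxnE !mxE /=; case: (_ == _) => /=; lia.
have := box_reach tau_ge0 tau_indep tau_id d_ge2 (ltn0Sn n) L_ge0 slow_le8 tE.
rewrite mul0rn => H; have {H} : 1 / 2 <= pcheap (lat_paths (inside n.+1 0) 0 (delta_mx 0 i *+ n))
    (@reach_cost R d n.+1 L) by move: H p_small; lra.
move=> /le_trans; apply; apply: (pcheap_mono tau_ge0).
  have n1 : 1 <= n%:R :> R by rewrite ler1n.
  have d0 : 0 <= d%:R :> R by [].
  rewrite /reach_cost /step_cost -(natr1 n).
  move: (n%:R : R) (d%:R : R) n1 d0 => x D x1 D0.
  have : 0 <= D * ((5 * L + 1) * (x - 1)).
    by rewrite mulr_ge0 // mulr_ge0 ?subr_ge0 // addr_ge0 // mulr_ge0.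
  lra.
by move=> r [q [wq rE _]]; exists q.
Qed.

Lemma spVN (u : V) : spV 1%g xpredT u = - u.
Proof. by apply/rowP => j; rewrite !mxE perm1 expr1 mulN1r. Qed.

Lemma good_nonempty u : good u !=set0.
Proof.
elim/vertex_ind: u => [|u v [a ga] [b gb]|i|i].
- exists 1; exists 1 => //; apply: filterS (U_ge 1) => n /= n0.
  by rewrite mul0rn pcheap_lat_paths_refl // mul1r ltr0n.
- by exists (a + b + 1); apply: good_add.
- by exists step_cost; apply: good_delta.
- by exists (step_cost + 1); rewrite -spVN; apply: good_spV => //; apply: good_delta.
Qed.

Lemma good_has_inf u : has_inf (good u).
Proof.
split; first exact: good_nonempty.
by exists 0 => a /good_gt0/ltW.
Qed.

Lemma nu_le u a : good u a -> nu u <= a.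
Proof. by move=> ga; apply: ge_inf => //; have [] := good_has_inf u. Qed.

Lemma nu_ge0 u : 0 <= nu u.
Proof. by apply: lb_le_inf; [exact: good_nonempty|move=> a /good_gt0/ltW]. Qed.

Lemma lt_nu_good u a : nu u < a -> good u a.
Proof.
by move=> /(inf_lt (good_nonempty u))[b gb ba]; apply: good_up gb; apply: ltW.
Qed.

Lemma nu_add u v : nu (u + v) <= nu u + nu v.
Proof.
apply/ler_addgt0Pr => e e0; have e3 : 0 < e / 3 by lra.
have gu : good u (nu u + e / 3) by apply: lt_nu_good; rewrite ltrDl.
have gv : good v (nu v + e / 3) by apply: lt_nu_good; rewrite ltrDl.
by apply: le_trans (nu_le (good_add e3 gu gv)) _; lra.
Qed.

Lemma nu_spV s sg u : nu (spV s sg u) <= nu u.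
Proof.
apply/ler_addgt0Pr => e e0; have e2 : 0 < e / 2 by lra.
have gu : good u (nu u + e / 2) by apply: lt_nu_good; rewrite ltrDl.
by apply: le_trans (nu_le (good_spV s sg e2 gu)) _; lra.
Qed.

Lemma nu0 : nu 0 = 0.
Proof.
apply/eqP; rewrite eq_le nu_ge0 andbT; apply/ler_addgt0Pr => e e0; rewrite add0r.
apply: nu_le; exists 1 => //; apply: filterS (U_ge 1) => n /= n0.
by rewrite mul0rn pcheap_lat_paths_refl // mulr_gt0 ?ltr0n.
Qed.

Lemma nu_mulrn u n : nu (u *+ n) <= n%:R * nu u.
Proof.
elim: n => [|n IH]; first by rewrite mulr0n nu0 mul0r.
by rewrite mulrSr; apply: le_trans (nu_add _ _) _; rewrite -natr1 mulrDl mul1r lerD2r.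
Qed.

Lemma nu_sum (u : 'I_d -> V) : nu (\sum_i u i) <= \sum_i nu (u i).
Proof.
elim/big_rec2: _ => [|i y x _ H]; first by rewrite nu0.
by apply: le_trans (nu_add _ _) _; rewrite lerD2l.
Qed.

Lemma nu_scale_le (v : V) (c : int) (b : R) : nu v <= b -> nu (- v) <= b ->
  nu (c *: v) <= (absz c)%:R * b.
Proof.
move=> vb nvb; have b0 : 0 <= b by apply: le_trans vb; apply: nu_ge0.
case: c => n.
  rewrite [n%:Z *: v](_ : _ = v *+ n); last by rewrite -scaler_nat natz.
  by apply: le_trans (nu_mulrn _ _) _; rewrite ler_wpM2l.
rewrite NegzE [_ *: v](_ : _ = (- v) *+ n.+1); last first.
  by rewrite scaleNr -scalerN -scaler_nat natz.
by apply: le_trans (nu_mulrn _ _) _; rewrite abszN ler_wpM2l.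
Qed.

Definition l1R (u : V) : R := \sum_i (absz (u 0%R i))%:R.

Lemma nu_l1 u : nu u <= step_cost * l1R u.
Proof.
rewrite {1}(basis_sum u); apply: le_trans (nu_sum _) _.
rewrite /l1R mulr_sumr; apply: ler_sum => i _; rewrite mulrC.
have nd : nu (delta_mx 0 i) <= step_cost by apply: nu_le; apply: good_delta.
apply: nu_scale_le => //; rewrite -spVN; exact: le_trans (nu_spV _ _ _) nd.
Qed.

(** A good [a] below [k * mu] would keep the passage time to [z *+ (k * n)], divided by [k * n],
    away from its limit [mu] with probability at least [delta] for arbitrarily large [n]. Where no
    limit exists, [xget] returns 0 and the claim is nonnegativity of [nu]. *)
Lemma time_constant_le_nu z k : k%:R * time_constant tau z <= nu (z *+ k).
Proof.
rewrite /time_constant; set S := (X in xget 0 X).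
case: xgetP => [mu _ /= Smu|_]; last by rewrite mulr0 nu_ge0.
have [mu0|mu0] := leP mu 0.
  by apply: le_trans (nu_ge0 _); rewrite mulr_ge0_le0.
apply: lb_le_inf; first exact: good_nonempty.
move=> a ga; have a0 := good_gt0 ga; rewrite leNgt; apply/negP => ak.
have k0 : (0 < k)%N by case: k ak {ga} => [|//]; rewrite mul0r ltNge (ltW a0).
have kR : 0 < k%:R :> R by rewrite ltr0n.
move: ga => [delta d0 Ud].
have e0 : 0 < mu - a / k%:R by rewrite subr_gt0 ltr_pdivrMr // mulrC.
pose D m := [set w | mu - a / k%:R <= `|passage_time tau 0 (z *+ m) w / m%:R - mu|].
have mD m : (0 < m)%N -> measurable (D m).
  move=> m0; apply: (measurable_dist_ge (f := fun w => passage_time tau 0 (z *+ m) w / m%:R)).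
  move=> b; have := measurable_passage_time (z *+ m) (b * m%:R); congr measurable.
  by apply/seteqP; split => w /=; rewrite ltr_pdivrMr ?ltr0n.
have := Smu _ e0; move=> /fine_cvgP[_ /cvgrPdist_lt /(_ _ d0)] [N _ HN].
have [n [/= nN Hn]] := filter_ex (filterI (U_ge (maxn N 1)) Ud).
have [n0 Nn] : (0 < n)%N /\ (N <= n)%N by lia.
have kn0 : (0 < k * n)%N by rewrite muln_gt0 k0.
have := HN (k * n)%N; rewrite /= sub0r normrN => /(_ _)/wrap[].
  by apply: leq_trans Nn _; rewrite leq_pmull.
rewrite -/(D (k * n)%N) -/(pr P (D (k * n)%N)) ger0_norm ?pr_ge0 // ltNge => /negP; apply.
apply: le_trans Hn _; rewrite -mulrnA; apply: le_pr; [exact: measurable_cheap|exact: mD|].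
rewrite -passage_timeE => w /= Tw; rewrite /D /= -normrN (le_trans _ (ler_norm _)) // opprB.
rewrite lerD2l lerN2 ltW // ltr_pdivrMr ?ltr0n // natrM mulrA divfK //.
by rewrite gt_eqF.
Qed.

End LimitNorm.

Section VertexNorms.
Variables (R : realType) (d : nat).
Local Notation V := (vertex d).

Lemma l1R_linf (w : V) (k : nat) : (linf w <= k)%N -> l1R w <= (d * k)%:R :> R.
Proof.
move=> /linf_leP H; apply: (@le_trans _ _ (\sum_(i < d) k%:R)).
  by apply: ler_sum => i _; rewrite ler_nat; move: (H i); move: (w 0 i) => x; lia.
by rewrite sumr_const card_ord natrM -[leLHS]mulr_natl.
Qed.

Lemma l1R_ge0 (w : V) : 0 <= l1R w :> R.
Proof. exact: sumr_ge0. Qed.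

Lemma l1R_norm (w : V) : l1R w = (l1norm w)%:~R :> R.
Proof.
rewrite /l1R /l1norm rmorph_sum /=; apply: eq_bigr => i _.
by rewrite -abszE pmulrn.
Qed.

Lemma linf_tile_rem n (z : V) : (0 < n)%N -> (linf (z - tile n z *+ n)%R <= n)%N.
Proof.
move=> n0; apply/linf_leP => i; rewrite mxE mxE mulmxnE.
have /(tileP n0)/(_ i) := erefl (tile n z); rewrite -mulr_natl natz.
by move: (tile n z 0 i) (z 0 i) => a b; lia.
Qed.

Lemma l1R_tile n (z : V) : (0 < n)%N -> n%:R * l1R (tile n z) <= l1R z + (d * n)%:R :> R.
Proof.
move=> n0; rewrite /l1R mulr_sumr (_ : (d * n)%:R = \sum_(i < d) n%:R); last first.
  by rewrite sumr_const card_ord natrM -[RHS]mulr_natl.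
rewrite -big_split /=; apply: ler_sum => i _; rewrite -natrM -natrD ler_nat.
have /(tileP n0)/(_ i) := erefl (tile n z).
move: (tile n z 0 i) (z 0 i) => a b; nia.
Qed.

End VertexNorms.

(** * Comparison of [nu] with the sup norm *)

Section LowerTail.
Context {disp : measure_display} {Omega : measurableType disp} {R : realType}.
Context {P : probability Omega R} {d : nat}.
Variables (tau : edge d -> {RV P >-> R}) (i0 : edge d).
Hypothesis tau_ge0 : forall i w, 0 <= tau i w.
Hypothesis tau_indep : mutually_independent tau.
Hypothesis tau_id : identically_distributed tau.
Hypothesis d_ge2 : (2 <= d)%N.
Local Notation V := (vertex d).
Local Notation E := (edge d).
Local Notation pcheap := (pcheap tau).
Local Notation all_paths := (lat_paths (fun _ : E => True)).
Variable L : R.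
Hypothesis L_ge0 : 0 <= L.
Local Notation p := (pr P (slow tau L i0)).
Hypothesis p_small : d%:R * (32 * p) <= 1 / 8.
Variable U : set_system nat.
Hypothesis U_ultra : UltraFilter U.
Hypothesis U_oo : \oo `<=` U.
Local Notation nu := (nu tau U).
Local Notation A := (@step_cost R d L).

Let nu_add' := nu_add tau_ge0 tau_indep tau_id d_ge2 L_ge0 p_small U_ultra U_oo.

Let nu_spV' := nu_spV tau_ge0 tau_indep tau_id d_ge2 L_ge0 p_small U_ultra U_oo.

(** A signed permutation moves a largest coordinate of [w] to the axis [j]; adding the image with
    opposite signs on all other axes cancels everything else. *)
Lemma nu_axis w j (b : bool) :
  nu (((-1) ^+ b * (2 * linf w)%:Z) *: delta_mx 0 j) <= 2 * nu w.
Proof.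
have [i iE] : exists i, linf w = absz (w 0 i).
  have d0 : (0 < #|'I_d|)%N by rewrite card_ord; lia.
  by have [i iE] := bigop.eq_bigmax (fun i => absz (w 0 i)) d0; exists i.
pose b' := b (+) (w 0 i < 0).
pose s := tperm i j.
pose sg1 l := if l == j then b' else false; pose sg2 l := if l == j then b' else true.
have -> : ((-1) ^+ b * (2 * linf w)%:Z) *: delta_mx 0 j = spV s sg1 w + spV s sg2 w.
  apply/rowP => l; rewrite !mxE eqxx /= /sg1 /sg2; case: (eqVneq l j) => [->|lj].
    rewrite /s tpermR iE /b' mulr1; have [w0|w0] := ltP (w 0 i) 0.
      by case: (b); rewrite /= ?expr0 ?expr1; lia.
    by case: (b); rewrite /= ?expr0 ?expr1; lia.
  by rewrite expr0 expr1 mulr0; lia.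
apply: le_trans (nu_add' _ _) _; rewrite mulr_natl mulr2n; by apply: lerD; apply: nu_spV'.
Qed.

(** By [nu_axis], [nu w] controls multiples of all basis vectors, hence of [z0]; so one positive
    time constant bounds [nu] below in every direction. *)
Lemma nu_linf z0 w : (linf w)%:R * time_constant tau z0 <= l1R z0 * nu w.
Proof.
suff: (2 * linf w)%N%:R * time_constant tau z0 <= l1R z0 * (2 * nu w).
  by rewrite natrM => H; rewrite -(@ler_pM2l _ 2) // mulrA (le_trans H) // mulrCA.
apply: le_trans (time_constant_le_nu tau_ge0 tau_indep tau_id d_ge2 L_ge0 p_small
  U_ultra U_oo z0 _) _.
rewrite {1}(basis_sum z0) -sumrMnl.
apply: le_trans (nu_sum tau_ge0 tau_indep tau_id d_ge2 L_ge0 p_small U_ultra U_oo _) _.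
rewrite /l1R mulr_suml; apply: ler_sum => j _.
rewrite scalerMnl -mulr_natr natz -scalerA.
apply: (nu_scale_le tau_ge0 tau_indep tau_id d_ge2 L_ge0 p_small U_ultra U_oo).
  by have := nu_axis w j false; rewrite expr0 mul1r.
by have := nu_axis w j true; rewrite expr1 mulN1r scaleNr.
Qed.

Lemma reach_cost_le n : (0 < n)%N -> @reach_cost R d n L <= A * n%:R.
Proof.
move=> n0; have n1 : 1 <= n%:R :> R by rewrite ler1n.
have d0 : 0 <= d%:R :> R by [].
rewrite /reach_cost /step_cost.
move: (n%:R : R) (d%:R : R) n1 d0 => x D x1 D0.
have : 0 <= D * (5 * L * x + (x - 1)).
  rewrite mulr_ge0 // addr_ge0 ?subr_ge0 // mulr_ge0 //; first by rewrite mulr_ge0.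
  lra.
lra.
Qed.

Lemma A_ge1 : 1 <= A.
Proof. by rewrite /step_cost lerDr mulr_ge0 // addr_ge0 // mulr_ge0. Qed.

Lemma nu_linf_le (w : V) (k : nat) : (linf w <= k)%N -> nu w <= A * (d * k)%:R.
Proof.
move=> wk; have := nu_l1 tau_ge0 tau_indep tau_id d_ge2 L_ge0 p_small U_ultra U_oo w.
move=> /le_trans; apply; apply: ler_wpM2l; first by have := A_ge1; lra.
exact: l1R_linf.
Qed.

End LowerTail.

Lemma tile0 (d n : nat) : (0 < n)%N -> tile n (0 : vertex d) = 0.
Proof. by move=> n0; apply/(tileP n0) => i; rewrite mxE; lia. Qed.

(** * The exponential bound at a fixed scale *)

Section LargeDeviation.
Context {disp : measure_display} {Omega : measurableType disp} {R : realType}.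
Context {P : probability Omega R} {d : nat}.
Variables (tau : edge d -> {RV P >-> R}) (i0 : edge d).
Hypothesis tau_ge0 : forall i w, 0 <= tau i w.
Hypothesis tau_indep : mutually_independent tau.
Hypothesis tau_id : identically_distributed tau.
Hypothesis d_ge2 : (2 <= d)%N.
Local Notation V := (vertex d).
Local Notation E := (edge d).
Local Notation pcheap := (pcheap tau).
Local Notation all_paths := (lat_paths (fun _ : E => True)).
Variable L : R.
Hypothesis L_ge0 : 0 <= L.
Local Notation p := (pr P (slow tau L i0)).
Hypothesis p_small : d%:R * (32 * p) <= 1 / 8.
Variable U : set_system nat.
Hypothesis U_ultra : UltraFilter U.
Hypothesis U_oo : \oo `<=` U.
Local Notation nu := (nu tau U).
Local Notation A := (@step_cost R d L).

Let nu_add' := nu_add tau_ge0 tau_indep tau_id d_ge2 L_ge0 p_small U_ultra U_oo.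
Let nu_ge0' := nu_ge0 tau_ge0 tau_indep tau_id d_ge2 L_ge0 p_small U_ultra U_oo.
Let nu_le' := nu_le tau_ge0 tau_indep tau_id d_ge2 L_ge0 p_small U_ultra U_oo.
Let nu_mulrn' := nu_mulrn tau_ge0 tau_indep tau_id d_ge2 L_ge0 p_small U_ultra U_oo.
Let nu_l1' := nu_l1 tau_ge0 tau_indep tau_id d_ge2 L_ge0 p_small U_ultra U_oo.
Let nu_linf_le' := nu_linf_le tau_ge0 tau_indep tau_id d_ge2 L_ge0 p_small U_ultra U_oo.

(** For each [w] the scales of large probability or the remaining ones form a set of the
    ultrafilter; the former would make [nu w - a] good. Finitely many sets of the ultrafilter have a
    common element. *)
Lemma good_scale (W : seq V) (a delta : R) : 0 < a -> 0 < delta ->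
  exists2 n, (0 < n)%N & {in W, forall w,
    pcheap (all_paths 0 (w *+ n)) ((nu w - a) * n%:R) < delta}.
Proof.
move=> a0 delta0.
suff UW : U [set n | (0 < n)%N /\ {in W, forall w,
    pcheap (all_paths 0 (w *+ n)) ((nu w - a) * n%:R) < delta}].
  by have [n [n0 Hn]] := filter_ex UW; exists n.
elim: W => [|w W IH].
  by apply: filterS (U_ge U_oo 1) => n n0; split.
have Uw : U [set n | pcheap (all_paths 0 (w *+ n)) ((nu w - a) * n%:R) < delta].
  have [Ud|Ud] := in_ultra_setVsetC [set n | delta <=
      pcheap (all_paths 0 (w *+ n)) ((nu w - a) * n%:R)] U_ultra.
    have : nu w <= nu w - a by apply: nu_le'; exists delta.
    by lra.
  by apply: filterS Ud => n /=; rewrite ltNge => /negP.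
apply: filterS (filterI Uw IH) => n [/= wn [n0 Wn]]; split=> // v.
by rewrite inE => /predU1P[->|/Wn].
Qed.

Variables (c e : R) (K n : nat).
Hypotheses (c_gt0 : 0 < c) (e_gt0 : 0 < e) (e_small : 6 * e <= c) (K_gt0 : (0 < K)%N).
Hypothesis n_gt0 : (0 < n)%N.
Hypothesis nu_ge : forall w, c * (linf w)%:R <= nu w.
Hypothesis K_big : 2 * A + 2 <= e * K%:R.
Variables (s delta : R).
Hypothesis s_gt0 : 0 < s.
Hypothesis few_steps : (size (steps d K))%:R * expR (- s * (e * K%:R)) <= 1 / 2.
Hypothesis rare_steps :
  (size (steps d K))%:R * (2 * delta * expR (s * (A * (d * K)%:R))) <= 1 / 2.
Hypothesis n_good : {in steps d K, forall w,
  pcheap (all_paths 0 (w *+ n)) ((nu w - e * K%:R) * n%:R) < delta}.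

Local Notation kappa := (c - 3 * e).
Local Notation numax := (A * (d * K)%:R).

(* n times this is the typical cost of k more steps that end near y_z: a
   skeleton either makes many steps, each of which costs at least kappa * K * n,
   or pays for the norm nu of its remaining displacement. *)
Definition toll (yz : V) (k : nat) (y : V) : R :=
  Num.min (kappa * K%:R * k%:R) (nu (yz - y) - numax - 3 * e * K%:R * k%:R).

(** Raising the loss from [e * K] to [2 * e * K] frees [e * K * n], which by [K_big] pays for two
    connections of cost at most [A * n] and two units of slack. *)
Lemma crossing_step y w (b : R) : w \in steps d K ->
  b <= n%:R * (nu w - 2 * e * K%:R) ->
  pcheap (crossings n y (y + w)) (b + 1) <= 2 * delta.
Proof.
move=> ws bE.
have p8 := slow_le8 d_ge2 L_ge0 p_small.
have yw : y != y + w.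
  apply/eqP => yE; move: ws; rewrite mem_steps => /eqP wK.
  have w0 : w = 0 by apply: (addrI y); rewrite addr0 -yE.
  move: K_gt0; rewrite -wK w0 lt0n => /negP; apply; rewrite -leqn0.
  by apply/linf_leP => i; rewrite mxE.
apply: le_trans (crossings_le tau_ge0 tau_indep tau_id d_ge2 n_gt0 L_ge0 p8
  (b + 1) yw p_small ltr01) _.
rewrite ler_pM2l // addrC addKr; apply: le_trans (ltW (n_good ws)).
apply: pcheap_mono => //; have := reach_cost_le (d := d) L_ge0 n_gt0.
have n1 : 1 <= n%:R :> R by rewrite ler1n.
move: (reach_cost _ _) (step_cost _) K_big bE => rc a.
move: (n%:R : R) (K%:R : R) (nu w) n1 => x k v x1 kb bE rcx.
have : 0 <= (x - 1) * 2 by rewrite mulr_ge0 ?subr_ge0.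
have : 0 <= x * (e * k - (2 * a + 2)) by rewrite mulr_ge0 ?subr_ge0 //; lra.
lra.
Qed.

(** The first term of the minimum uses [nu w >= c * K], the reason for [kappa = c - 3 * e]; the
    second uses subadditivity. *)
Lemma toll_step yz k y w : w \in steps d K ->
  toll yz k.+1 y <= toll yz k (y + w) + (nu w - 3 * e * K%:R).
Proof.
rewrite mem_steps => /eqP wK; have cw := nu_ge w; rewrite wK in cw.
have sub : nu (yz - y) <= nu (yz - (y + w)) + nu w.
  by rewrite -(_ : yz - (y + w) + w = yz - y) ?nu_add' // opprD -!addrA addNr addr0.
rewrite /toll -(natr1 k) addr_minl le_min !ge_min; apply/andP; split; apply/orP; [left|right].
  by move: cw; lra.
by move: sub; lra.
Qed.

(** The threshold of a step is [2 * e * K] below [nu w], the toll counts [3 * e * K]: the difference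
    leaves a factor [expR (- s * (e * K))] per step, which [few_steps] sums to 1/2. Exceptionally
    cheap steps contribute the other 1/2 by [rare_steps]. *)
Lemma skeleton_bound yz y a k :
  pcheap (ichains (crossings n) (tile_succ K) (near_target K yz) k y) a <=
  expR (s / n%:R * a) * expR (- s * toll yz k y).
Proof.
have nR : 0 < n%:R :> R by rewrite ltr0n.
(* The cap [numax] bounds the thresholds uniformly over all pairs; for actual steps it is
   inactive. *)
pose bb (y y' : V) := n%:R * (Num.min (nu (y' - y)) numax - 2 * e * K%:R).
have K0 : 0 <= K%:R :> R by [].
have A0 : 0 <= A by have := A_ge1 (R := R) (d := d) L_ge0; lra.
have numax0 : 0 <= numax by rewrite mulr_ge0.
apply: (pcheap_ichains i0 tau_ge0 tau_indep tau_id (B := fun k y => expR (- s * toll yz k y))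
  (bb := bb) (bmax := n%:R * numax) (eta := 1)) => //.
- by rewrite divr_gt0.
- move=> u v; rewrite /bb ler_wpM2l // lerBlDr ge_min; apply/orP; right.
  by rewrite lerDl !mulr_ge0 // ltW.
- move=> u; rewrite -[leLHS]expR0 ler_expR mulNr -mulrN mulr_ge0 ?(ltW s_gt0) //.
  by rewrite oppr_ge0 /toll mulr0 ge_min lexx.
- move=> j u near; rewrite -[leLHS]expR0 ler_expR mulNr -mulrN mulr_ge0 ?(ltW s_gt0) //.
  rewrite oppr_ge0 /toll ge_min; apply/orP; right.
  have /nu_linf_le' : (linf (yz - u)%R <= K)%N by apply: ltnW.
  have : 0 <= 3 * e * K%:R * j%:R by rewrite !mulr_ge0 // ltW.
  lra.
move=> j u _; rewrite /tile_succ big_map.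
have key w : w \in steps d K ->
    (expR (- (s / n%:R) * bb u (u + w)) + pcheap (crossings n u (u + w)) (bb u (u + w) + 1))
      * expR (- s * toll yz j (u + w)) <=
    (expR (- s * (e * K%:R)) + 2 * delta * expR (s * numax)) * expR (- s * toll yz j.+1 u).
  move=> ws; have wK := ws; rewrite mem_steps in wK; move/eqP: wK => wK.
  have numw : nu w <= numax by apply: nu_linf_le'; rewrite wK.
  have bE : bb u (u + w) = n%:R * (nu w - 2 * e * K%:R).
    by rewrite /bb [u + w]addrC addrK min_l.
  have tE : expR (- s * toll yz j (u + w)) <=
      expR (- s * toll yz j.+1 u) * expR (s * (nu w - 3 * e * K%:R)).
    rewrite -expRD ler_expR; have := ler_wpM2l (ltW s_gt0) (toll_step yz j u ws).
    rewrite mulrDr; lra.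
  apply: le_trans (ler_wpM2l _ tE) _; first by rewrite addr_ge0 ?expR_ge0 ?pcheap_ge0.
  rewrite mulrCA mulrC; apply: ler_wpM2r; first exact: expR_ge0.
  rewrite mulrDl; apply: lerD.
    rewrite bE -expRD ler_expR.
    have -> : - (s / n%:R) * (n%:R * (nu w - 2 * e * K%:R)) = - s * (nu w - 2 * e * K%:R).
      by rewrite mulNr mulrA divfK ?gt_eqF // mulNr.
    by rewrite !mulNr !mulrBr; lra.
  apply: ler_pM; rewrite ?pcheap_ge0 ?expR_ge0 //.
    by apply: crossing_step => //; rewrite bE.
  rewrite ler_expR ler_pM2l //.
  by apply: le_trans numw; rewrite gerBl !mulr_ge0 // ltW.
rewrite big_seq; apply: le_trans (ler_sum _ key) _.
rewrite -big_seq big_const_seq count_predT iter_addr addr0 -[leLHS]mulr_natl [leLHS]mulrA.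
apply: ler_piMl; first exact: expR_ge0.
by rewrite mulrDr; move: few_steps rare_steps; lra.
Qed.

Lemma lower_tail_scale (eps : R) : 0 < eps -> 12 * e * A <= eps * c ->
  exists M, forall z x, l1R z <= x ->
    pcheap (all_paths 0 z) (time_constant tau z - eps * x) <=
    M * expR (- (s / n%:R * (eps / 2)) * x).
Proof.
move=> eps0 e_eps.
have nR : 0 < n%:R :> R by rewrite ltr0n.
have KR : 0 < K%:R :> R by rewrite ltr0n.
have e1 := e_gt0; have c1 := c_gt0; have ec := e_small.
have A1 := A_ge1 (R := R) (d := d) L_ge0.
pose dn : R := (d * n)%:R.
have kap : c / 2 <= kappa by lra.
(* [C] collects the remainders that depend on neither [z] nor [x]. *)
pose C := A * dn + n%:R * numax + 3 * e * K%:R * n%:R + eps / 2 * dn.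
exists (expR (s / n%:R * C)) => z x zx.
pose yz := tile n z.
(* So many steps cost at least [nu yz], hence the displacement term is the minimum in [toll]; yet
   [k] grows at most linearly in [z]. *)
pose k := (Num.truncn (nu yz / (kappa * K%:R))).+1.
have kK0 : 0 < kappa * K%:R by rewrite mulr_gt0 //; lra.
have k_ge : nu yz <= kappa * K%:R * k%:R.
  by rewrite mulrC -ler_pdivrMr // ltW // truncnS_gt.
have k_le : kappa * K%:R * k%:R <= nu yz + kappa * K%:R.
  rewrite /k -(natr1 (Num.truncn _)) mulrDr mulr1 lerD2r mulrC -ler_pdivlMr //.
  by have /andP[] := truncn_itv (divr_ge0 (nu_ge0' yz) (ltW kK0)).
have tollE : toll yz k 0 = nu yz - numax - 3 * e * K%:R * k%:R.
  rewrite /toll subr0 min_r //; apply: le_trans k_ge.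
  have : 0 <= 3 * e * K%:R * k%:R by rewrite !mulr_ge0 // ltW.
  have : 0 <= numax by rewrite mulr_ge0 //; lra.
  lra.
have Hcover : pcheap (all_paths 0 z) (time_constant tau z - eps * x) <=
    pcheap (ichains (crossings n) (tile_succ K) (near_target K yz) k 0)
      (time_constant tau z - eps * x).
  apply: pcheap_cover => // r [q [wq -> _]] ur.
  have [t [Ct sub]] := skeleton n_gt0 K_gt0 k (erefl yz) wq.
  rewrite tile0 // in Ct; exists t; split=> //; first exact: subseq_uniq sub ur.
  exact: mem_subseq.
apply: le_trans Hcover _; apply: le_trans (skeleton_bound _ _ _ _) _.
rewrite -!expRD ler_expR tollE.
have tc : time_constant tau z <= n%:R * nu yz + A * dn.
  have := time_constant_le_nu tau_ge0 tau_indep tau_id d_ge2 L_ge0 p_small U_ultra U_oo z 1.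
  rewrite mul1r mulr1n => /le_trans; apply.
  rewrite -{1}(subrK (yz *+ n) z) addrC; apply: le_trans (nu_add' _ _) _.
  by apply: lerD; [exact: nu_mulrn'|apply: nu_linf_le'; apply: linf_tile_rem].
have l1yz : n%:R * l1R yz <= x + dn by apply: le_trans (l1R_tile R z n_gt0) _; rewrite lerD2r.
have nu_yz := nu_l1' yz.
(* The losses of all steps consume half of [eps], by [12 * e * A <= eps * c] and [kappa >= c / 2];
   the other half is the exponential rate. *)
have cost : n%:R * (3 * e * K%:R * k%:R) <= eps / 2 * (x + dn) + 3 * e * K%:R * n%:R.
  have k1 : 1 <= k%:R :> R by rewrite ler1n.
  have h0 : 0 <= K%:R * k%:R - K%:R :> R by rewrite subr_ge0 ler_peMr.
  have l0 : 0 <= l1R yz :> R by apply: l1R_ge0.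
  have h1 : c / 2 * (K%:R * k%:R - K%:R) <= A * l1R yz.
    by have := ler_wpM2r h0 kap; move: k_le nu_yz; lra.
  have h2 : 3 * e * (K%:R * k%:R - K%:R) <= eps / 2 * l1R yz.
    have c2 : 0 < c / 2 by lra.
    rewrite -(ler_pM2l c2) mulrCA; have e3 : 0 <= 3 * e by lra.
    apply: le_trans (ler_wpM2l e3 h1) _.
    by have := ler_wpM2r l0 e_eps; lra.
  have h3 := ler_wpM2l (ltW nR) h2.
  have h4 : eps / 2 * (n%:R * l1R yz) <= eps / 2 * (x + dn).
    by rewrite ler_wpM2l //; lra.
  by move: h3 h4; lra.
have sn : 0 < s / n%:R by rewrite divr_gt0.
have sE : s = s / n%:R * n%:R by rewrite divfK ?gt_eqF.
rewrite [X in _ + - X * _]sE; set l := s / n%:R in sn *.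
have : 0 <= l * (C + eps / 2 * x - time_constant tau z + n%:R * nu yz - n%:R * numax
    - n%:R * (3 * e * K%:R * k%:R)).
  apply: mulr_ge0; first exact: ltW.
  by move: cost tc; rewrite /C; lra.
lra.
Qed.

End LargeDeviation.

Theorem theorem3 (disp : measure_display) (Omega : measurableType disp)
    (R : realType) (P : probability Omega R) (d : nat) (hd : (2 <= d)%N)
    (tau : edge d -> {RV P >-> R})
    (tau_ge0 : forall (e : edge d) (w : Omega), 0 <= tau e w)
    (tau_indep : mutually_independent tau)
    (tau_id : identically_distributed tau)
    (eps : R) (eps_gt0 : 0 < eps) :
  exists M gamma : R, 0 < gamma /\
    forall (z : vertex d) (x : R), (l1norm z)%:~R <= x ->
      (P [set w | (passage_time tau 0 z w - time_constant tau z < - eps * x)%R]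
       <= (M * expR (- gamma * x))%:E)%E.
Proof.
have d0 : (0 < d)%N by apply: leq_trans hd.
pose i0 : edge d := (0, Ordinal d0).
have dR : 0 < d%:R :> R by rewrite ltr0n.
have eventE z x : [set w | passage_time tau 0 z w - time_constant tau z < - eps * x] =
    cheap tau (lat_paths (fun=> True) 0 z) (time_constant tau z - eps * x).
  rewrite -(passage_timeE tau_ge0); apply/seteqP; split => w /=; lra.
have l1ge0 (z : vertex d) x : (l1norm z)%:~R <= x -> 0 <= x :> R.
  by apply: le_trans; rewrite -l1R_norm l1R_ge0.
(* Without a positive time constant the event is empty, since passage times are nonnegative. *)
have [[z0 z0_gt0]|none] := pselect (exists z, 0 < time_constant tau z); last first.
  exists 0, 1; split=> // z x /l1ge0 x0; rewrite eventE mul0r.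
  rewrite (_ : cheap _ _ _ = set0) ?measure0 //; apply/seteqP; split => // w [r [_ _]].
  rewrite ltNge => /negP; apply; apply: (@le_trans _ _ 0); last exact: sumr_ge0.
  have : ~~ (0 < time_constant tau z) by apply/negP => ?; apply: none; exists z.
  have : 0 <= eps * x by rewrite mulr_ge0 // ltW.
  by rewrite -leNgt; lra.
have p0_gt0 : 0 < (256 * d%:R)^-1 :> R by rewrite invr_gt0 mulr_gt0.
have [L L0 pL] := pr_slow_small tau i0 p0_gt0.
have p_small : d%:R * (32 * pr P (slow tau L i0)) <= 1 / 8.
  move: pL; rewrite -(ler_pM2l dR) invfM mulrCA divff ?gt_eqF // mulr1.
  by rewrite mulrCA; lra.
have [U [U_ultra U_oo]] := @ultraFilterLemma nat \oo _.
pose A := @step_cost R d L; pose nu := nu tau U.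
have A1 : 1 <= A by apply: A_ge1.
have nu_lower := nu_linf tau_ge0 tau_indep tau_id hd L0 p_small U_ultra U_oo z0.
have l1_gt0 : 0 < l1R z0 :> R.
  rewrite lt_def l1R_ge0 andbT; apply/eqP => l10.
  have := nu_l1 tau_ge0 tau_indep tau_id hd L0 p_small U_ultra U_oo z0.
  have := time_constant_le_nu tau_ge0 tau_indep tau_id hd L0 p_small U_ultra U_oo z0 1.
  by rewrite l10 mulr0 mul1r mulr1n; lra.
pose c := time_constant tau z0 / l1R z0.
have c0 : 0 < c by apply: divr_gt0.
have nu_ge w : c * (linf w)%:R <= nu w.
  rewrite mulrAC ler_pdivrMr // mulrC [leRHS]mulrC.
  exact: nu_lower.
(* The first bound gives [c - 3 * e >= c / 2], the second limits the total loss to half of [eps]. *)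
pose e := Num.min (c / 6) (eps * c / (12 * A)).
have A0 : 0 < A by lra.
have e0 : 0 < e.
  by rewrite lt_min; apply/andP; split; apply: divr_gt0 => //; apply: mulr_gt0.
have e_c : 6 * e <= c.
  suff : e <= c / 6 by lra.
  by rewrite ge_min lexx.
have e_eps : 12 * e * A <= eps * c.
  have A12 : 0 < 12 * A by rewrite mulr_gt0.
  suff : e * (12 * A) <= eps * c by lra.
  by rewrite -ler_pdivlMr // ge_min lexx orbT.
pose K := (Num.truncn ((2 * A + 2) / e)).+1.
have K_big : 2 * A + 2 <= e * K%:R.
  by rewrite [leRHS]mulrC -ler_pdivrMr // ltW // truncnS_gt.
have eK : 0 < e * K%:R by rewrite mulr_gt0 ?ltr0n.
pose S : R := (size (steps d K))%:R.
have S0 : 0 <= S by [].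
(* With [t = 2 * (S + 1)], the inequality [1 + t <= expR t] gives [S * expR (- t) <= 1 / 2]. *)
pose s := 2 * (S + 1) / (e * K%:R).
have s0 : 0 < s by rewrite divr_gt0 // mulr_gt0 //; lra.
have few : S * expR (- s * (e * K%:R)) <= 1 / 2.
  rewrite mulNr divfK ?gt_eqF // expRN ler_pdivrMr ?expR_gt0 //.
  by have := expR_ge1Dx (2 * (S + 1)); lra.
pose X := expR (s * (A * (d * K)%:R)).
have X0 : 0 < X by apply: expR_gt0.
pose delta := (4 * (S + 1) * X)^-1.
have delta0 : 0 < delta by rewrite invr_gt0 !mulr_gt0 //; lra.
have rare : S * (2 * delta * X) <= 1 / 2.
  have S1 : 0 < S + 1 by lra.
  rewrite /delta invfM -[2 * _ * X]mulrA -(mulrA _ X^-1) mulVf ?gt_eqF // mulr1.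
  by rewrite invfM mulrCA mulrA mulrA ler_pdivrMr //; lra.
(* The scale comes last: [S], [s] and [delta] do not depend on it. *)
have [n n0 n_good] := good_scale tau_ge0 tau_indep tau_id hd L0 p_small U_ultra U_oo
  (steps d K) eK delta0.
have [M HM] := lower_tail_scale tau_ge0 tau_indep tau_id hd L0 p_small U_ultra U_oo
  c0 e0 e_c (ltn0Sn _) n0 nu_ge K_big s0 few rare n_good eps_gt0 e_eps.
exists M, (s / n%:R * (eps / 2)); split.
  by apply: mulr_gt0; apply: divr_gt0; rewrite ?ltr0n.
move=> z x zx; rewrite eventE -(prE P (measurable_cheap _ _ _)) lee_fin.
by apply: HM; rewrite l1R_norm.
Qed.
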